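(* For every permutation rack $(X,\varphi)$ there is a spectral sequence of homological type whose $\mathrm{E}^2$ page is given by $$\mathrm{E}^2_{\bullet,q}\;\cong\;\overline{\mathrm{H}}_\bullet(X/\!\!/\varphi)^{\otimes(q-1)}\otimes\mathrm{H}_\bullet(X/\!\!/\varphi),$$ (for $q\geqslant 1$; for $q=0$ the right-hand side is read as $\mathbb{Z}$ concentrated in degree $0$), and which abuts to the rack homology $\mathrm{HR}_\bullet(X,\varphi)$ of $(X,\varphi)$. This spectral sequence always degenerates from its $\mathrm{E}^2$ page on.
   Context: A rack $(X,\rhd)$ is a set $X$ with a binary operation $\rhd$ such that every left multiplication $y\mapsto x\rhd y$ is a bijection and $x\rhd(y\rhd z)=(x\rhd y)\rhd(x\rhd z)$ for all $x,y,z\in X$. A permutation rack $(X,\varphi)$ is a set $X$ with a permutation $\varphi\colon X\to X$ and the rack operation $x\rhd y=\varphi(y)$. Rack homology: let $\mathrm{CR}_n(X,\varphi)=(\mathbb{Z}X)^{\otimes n}=\mathbb{Z}(X^n)$ for $n\geqslant 0$ (so $\mathrm{CR}_0=\mathbb{Z}$), with basis elements written as noncommutative monomials $x_1\cdots x_n$, and differential $\mathrm{d}\colon\mathrm{CR}_n\to\mathrm{CR}_{n-1}$, $$\mathrm{d}(x_1\cdots x_n)=\sum_{k=1}^{n-1}(-1)^{k-1}\bigl(x_1\cdots x_{k-1}x_{k+1}\cdots x_n-x_1\cdots x_{k-1}\,\varphi(x_{k+1})\cdots\varphi(x_n)\bigr).$$ The rack homology $\mathrm{HR}_n(X,\varphi)$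 is the $n$-th homology of this chain complex. The homotopy orbit space $X/\!\!/\varphi$ is the Borel construction $\mathrm{E}\mathbb{Z}\times_{\mathbb{Z}}X$ of the action of the infinite cyclic group $\mathbb{Z}$ on the discrete set $X$ in which $n$ acts as $\varphi^n$; equivalently, up to homotopy, it is the mapping torus $\mathbb{R}\times_{\mathbb{Z}}X$ of $\varphi$. $\mathrm{H}_\bullet$ denotes integral homology and $\overline{\mathrm{H}}_\bullet$ denotes reduced integral homology, i.e. the kernel of the map to the homology of a point. Tensor products are over $\mathbb{Z}$ and are tensor products of graded abelian groups; $\mathrm{E}^2_{p,q}$ is the part of degree $p$ of the displayed graded tensor product. A spectral sequence of homological type has differentials $d^r\colon \mathrm{E}^r_{p,q}\to \mathrm{E}^r_{p-r,q+r-1}$; that it abuts to $\mathrm{HR}_\bullet(X,\varphi)$ means that $\mathrm{E}^\infty_{p,q}$, for $p+q=n$, are the subquotients of a finite filtration of $\mathrm{HR}_n(X,\varphi)$. It degenerates from its $\mathrm{E}^2$ page on if all differentials $d^r$ with $r\geqslant 2$ vanish. *)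

(* Defs.v *)
From HB Require Import structures.
From mathcomp Require Import zify freeg.
From mathcomp Require Import all_boot all_order all_algebra.
From mathcomp Require Import generic_quotient ring_quotient.
From mathcomp Require Import all_classical all_reals topology normedtype.

Set Implicit Arguments.
Unset Strict Implicit.
Unset Printing Implicit Defensive.

Import Order.TTheory GRing.Theory Num.Theory.
Import numFieldNormedType.Exports.

Local Open Scope classical_set_scope.
Local Open Scope ring_scope.
Local Open Scope quotient_scope.

Definition zmod_iso (A B : zmodType) : Type :=
  {f : {additive A -> B} | bijective f}.

Definition isomorphic (A B : zmodType) : Prop := inhabited (zmod_iso A B).

Definition zmod0 : zmodType := 'rV[int]_0.

Section Subgroup.
Variables (V : zmodType) (A : zmodClosed V).

Record subgroup := Subgroup { subgroup_val : V; _ : subgroup_val \in A }.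

HB.instance Definition _ := [isSub for subgroup_val].
HB.instance Definition _ := [Choice of subgroup by <:].
HB.instance Definition _ := [SubChoice_isSubZmodule of subgroup by <:].
End Subgroup.

Section Subquotient.
Variables (V : zmodType) (A B : zmodClosed V).

Definition in_subgroup : {pred subgroup A} := [pred x | val x \in B].

Lemma in_subgroup_closed : zmod_closed in_subgroup.
Proof.
split; first by rewrite !inE raddf0 rpred0.
by move=> x y; rewrite !inE raddfB => Bx By; rewrite rpredB.
Qed.

HB.instance Definition _ :=
  GRing.isZmodClosed.Build (subgroup A) in_subgroup in_subgroup_closed.

(* The quotient of [A] by its intersection with [B]; in all uses below [B] is
   contained in [A]. *)
Definition subquotient : zmodType := Quotient.quot in_subgroup.

Definition subquotient_class (x : V) (Ax : x \in A) : subquotient :=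
  \pi_(Quotient.quot in_subgroup) (Subgroup Ax).
End Subquotient.

Section SubquotientTheory.
Variables (V : zmodType) (A B : zmodClosed V).

Lemma subquotient_classP (c : subquotient A B) : exists x (Ax : x \in A), c = subquotient_class B Ax.
Proof. by rewrite -[c]reprK; case: (repr c) => x Ax; exists x, Ax. Qed.

Lemma subquotient_class_eq (x y : V) (Ax : x \in A) (Ay : y \in A) :
  x = y -> subquotient_class B Ax = subquotient_class B Ay.
Proof. by move=> e; congr (\pi _); apply: val_inj. Qed.

Lemma subquotient_classB (x y : V) (Ax : x \in A) (Ay : y \in A) :
  subquotient_class B (rpredB Ax Ay) = subquotient_class B Ax - subquotient_class B Ay.
Proof. by rewrite /subquotient_class -raddfB; congr (\pi _); apply: val_inj. Qed.
End SubquotientTheory.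

Section SubquotientMap.
Variables (V W : zmodType) (A B : zmodClosed V) (A' B' : zmodClosed W).
Variables (f : {additive V -> W}).
Hypotheses (fA : forall x, x \in A -> f x \in A')
           (fB : forall x, x \in B -> f x \in B').

Definition subquotient_map (c : subquotient A B) : subquotient A' B' :=
  subquotient_class B' (fA (valP (repr c))).

Lemma subquotient_mapE (x : V) (Ax : x \in A) :
  subquotient_map (subquotient_class B Ax) = subquotient_class B' (fA Ax).
Proof.
rewrite /subquotient_map /subquotient_class; apply/eqP; rewrite -Quotient.idealrBE.
rewrite inE raddfB /= -raddfB; apply: fB.
set y := repr _.
have : y = Subgroup Ax %[mod Quotient.quot (in_subgroup B)] by rewrite reprK.
by move/eqP; rewrite -Quotient.idealrBE inE raddfB.
Qed.

Lemma subquotient_map_additive : zmod_morphism subquotient_map.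
Proof.
move=> c d; have [x [Ax ->]] := subquotient_classP c; have [y [Ay ->]] := subquotient_classP d.
by rewrite -subquotient_classB !subquotient_mapE -subquotient_classB; apply: subquotient_class_eq; rewrite raddfB.
Qed.

End SubquotientMap.

Section Kernel.
Variables (V W : zmodType) (f : {additive V -> W}).

Definition kernel_of : {pred V} := [pred x | f x == 0].

Lemma kernel_of_closed : zmod_closed kernel_of.
Proof.
split; first by rewrite inE raddf0.
by move=> x y; rewrite !inE raddfB => /eqP-> /eqP->; rewrite subrr.
Qed.

HB.instance Definition _ := GRing.isZmodClosed.Build V kernel_of kernel_of_closed.

Definition image_of : {pred W} := [pred y | `[< exists x, y = f x >]].

Lemma image_of_closed : zmod_closed image_of.
Proof.
split; first by apply/asboolP; exists 0; rewrite raddf0.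
by move=> _ _ /asboolP[a ->] /asboolP[b ->]; apply/asboolP; exists (a - b); rewrite raddfB.
Qed.

HB.instance Definition _ := GRing.isZmodClosed.Build W image_of image_of_closed.
End Kernel.

Section FreeMap.
Variables (K : choiceType) (V : zmodType) (f : K -> V).

Definition free_map (D : {freeg K}) : V :=
  @fglift int (zmodule V) K f D.

Lemma free_map_additive : zmod_morphism free_map.
Proof. exact: (@lift_is_additive int K (zmodule V) f). Qed.

HB.instance Definition _ :=
  GRing.isZmodMorphism.Build {freeg K} V free_map free_map_additive.

Lemma free_mapU k : free_map << k >> = f k.
Proof. by rewrite /free_map liftU scale1r. Qed.
End FreeMap.

Lemma free_map_ext (K : choiceType) (V : zmodType)
    (f g : {additive {freeg K} -> V}) :
  (forall k, f << k >> = g << k >>) -> f =1 g.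
Proof.
move=> e D; rewrite -(freeg_sumE D) !raddf_sum; apply: eq_bigr => k _.
rewrite (_ : << _ *g k >> = << k >> *~ coeff k D) ?raddfMz ?e //.
by rewrite freegU_mulz intz.
Qed.

Section Generated.
Variables (V : zmodType) (S : set V).

Definition generated : {pred V} :=
  [pred x | `[< forall G : zmodClosed V, (forall s, S s -> s \in G) -> x \in G >]].

Lemma generated_closed : zmod_closed generated.
Proof.
split; first by apply/asboolP => G _; rewrite rpred0.
move=> x y /asboolP Sx /asboolP Sy; apply/asboolP => G SG.
by rewrite rpredB ?Sx ?Sy.
Qed.

HB.instance Definition _ := GRing.isZmodClosed.Build V generated generated_closed.
End Generated.

Definition tensor (A B : zmodType) : zmodType :=
  Quotient.quot (generated (V := {freeg (A * B)%type})
    ([set s | exists a a' b, s = << (a + a', b) >> - << (a, b) >> - << (a', b) >>]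
 `|` [set s | exists a b b', s = << (a, b + b') >> - << (a, b) >> - << (a, b') >>])).

Fixpoint direct_sum (A : nat -> zmodType) (n : nat) : zmodType :=
  if n is m.+1 then (direct_sum A m * A m)%type else zmod0.

Definition graded_unit (p : nat) : zmodType := if p is 0 then int else zmod0.

(* [p - i] is not truncated, since [i] ranges over 0, ..., p. *)
Definition graded_tensor (A B : nat -> zmodType) (p : nat) : zmodType :=
  direct_sum (fun i => tensor (A i) (B (p - i)%N)) p.+1.

Fixpoint graded_power (A : nat -> zmodType) (k : nat) : nat -> zmodType :=
  if k is j.+1 then graded_tensor A (graded_power A j) else graded_unit.

(* Extension by zero to negative degrees. *)
Definition nonneg (A : nat -> zmodType) (n : int) : zmodType :=
  if n is Posz m then A m else zmod0.

Record chain_complex := ChainComplex {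
  chains :> nat -> zmodType;
  bd : forall n, {additive chains n.+1 -> chains n};
  bd_bd : forall n x, bd n (bd n.+1 x) = 0
}.

Section Homology.
Variables (C : chain_complex) (n : nat).

Definition is_cycle : C n -> bool :=
  match n return C n -> bool with
  | 0 => fun=> true
  | m.+1 => fun x => bd C m x == 0
  end.

Definition cycles : {pred C n} := is_cycle.

Lemma cycles_closed : zmod_closed cycles.
Proof.
rewrite /cycles /is_cycle; case: n => [|m] //.
exact: (kernel_of_closed (bd C m)).
Qed.

HB.instance Definition _ := GRing.isZmodClosed.Build (C n) cycles cycles_closed.

Definition homology : zmodType := subquotient cycles (image_of (bd C n)).
End Homology.
Arguments cycles C n : clear implicits.

Record chain_map (C D : chain_complex) := ChainMap {
  chain_fun :> forall n, {additive C n -> D n};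
  chain_fun_bd : forall n x, bd D n (chain_fun n.+1 x) = chain_fun n (bd C n x)
}.

Section HomologyMap.
Variables (C D : chain_complex) (f : chain_map C D) (n : nat).

Lemma chain_map_cycles x : x \in cycles C n -> f n x \in cycles D n.
Proof.
rewrite !unfold_in /cycles /is_cycle; case: n x => [|m] //= x /eqP dx.
by rewrite chain_fun_bd dx raddf0.
Qed.

Lemma chain_map_boundaries x : x \in image_of (bd C n) -> f n x \in image_of (bd D n).
Proof.
move=> /asboolP[y ->]; apply/asboolP.
by exists (f n.+1 y); rewrite chain_fun_bd.
Qed.

Definition homology_map : homology C n -> homology D n :=
  @subquotient_map _ _ _ _ _ _ (f n) chain_map_cycles.

Lemma homology_map_additive : zmod_morphism homology_map.
Proof. exact: subquotient_map_additive chain_map_boundaries. Qed.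

HB.instance Definition _ := GRing.isZmodMorphism.Build
  (homology C n) (homology D n) homology_map homology_map_additive.
End HomologyMap.
Arguments homology_map {C D} f n.

Lemma bump_bump (a b m : nat) : (a <= b)%N ->
  bump (bump 0 b) (bump a m) = bump a (bump b m).
Proof.
rewrite /bump /= add1n => ab.
by case: (leqP a m) => am; case: (leqP b m) => bm; do 2?case: leqP => ?; lia.
Qed.

Lemma alternating_sum_sq (V : lmodType int) (n : nat) (F : 'I_n.+1 -> 'I_n -> V) :
  (forall i j : 'I_n, (i <= j)%N ->
     F (lift ord0 j) i = F (widen_ord (leqnSn n) i) j) ->
  \sum_(j < n.+1) \sum_(i < n) (-1) ^+ (j + i) *: F j i = 0.
Proof.
move=> FE; pose G (j : 'I_n.+1) (i : 'I_n) := (-1) ^+ (j + i) *: F j i.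
rewrite -/(\sum_(j < n.+1) \sum_(i < n) G j i).
rewrite (eq_bigr (fun j : 'I_n.+1 => \sum_(i < n | (i < j)%N) G j i
   + \sum_(i < n | (j <= i)%N) G j i)); last first.
  move=> j _; rewrite (bigID (fun i : 'I_n => (i < j)%N)) /=; congr (_ + _).
  by apply: eq_bigl => i; rewrite -leqNgt.
rewrite big_split /= big_ord_recl [X in X + _ + _]big_pred0 // add0r.
rewrite [X in _ + X]big_ord_recr /= [X in _ + (_ + X)]big_pred0; last first.
  by move=> i; rewrite leqNgt ltn_ord.
rewrite addr0 [X in _ + X](eq_bigr (fun j : 'I_n => \sum_(i < n | (j <= i)%N)
   G (widen_ord (leqnSn n) j) i)) //.
rewrite [X in _ + X](exchange_big_dep predT) //= -big_split /= big1 // => j _.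
rewrite -big_split big1 //= => i; rewrite /bump /= add1n ltnS => ij.
by rewrite /G /= FE // /bump /= add1n addSn exprS mulN1r scaleNr addnC addNr.
Qed.

Lemma additiveZ (U V : lmodType int) (f : {additive U -> V}) (a : int) x :
  f (a *: x) = a *: f x.
Proof. by rewrite -[a in LHS]intz -[a in RHS]intz !scaler_int raddfMz. Qed.

Section Singular.
Variable R : realType.

Definition simplex_set n : set 'rV[R]_n.+1 :=
  [set t | (forall i, 0 <= t 0 i) /\ \sum_i t 0 i = 1].

Definition simplex (n : nat) : topologicalType := set_type (@simplex_set n).

Section SimplexMap.
Variables (n m : nat) (f : 'I_n.+1 -> 'I_m.+1).

(* The affine map given by [f] on the vertices. *)
Definition simplex_map_row (t : 'rV[R]_n.+1) : 'rV[R]_m.+1 :=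
  \row_j \sum_(i | f i == j) t 0 i.

Lemma simplex_map_subproof (t : simplex n) :
  simplex_map_row (val t) \in @simplex_set m.
Proof.
case: t => t /=; rewrite !inE => -[t0 t1]; split=> [j|].
  by rewrite mxE sumr_ge0.
rewrite -[RHS]t1 [RHS](partition_big f predT) //=.
by apply: eq_bigr => j _; rewrite mxE.
Qed.

Definition simplex_map (t : simplex n) : simplex m :=
  exist _ (simplex_map_row (val t)) (simplex_map_subproof t).

Lemma simplex_map_row_continuous : continuous simplex_map_row.
Proof.
have -> : simplex_map_row =
    (fun t => \sum_j (\sum_(i | f i == j) t 0 i) *: delta_mx 0 j).
  apply/funext => t; rewrite [LHS]row_sum_delta.
  by apply: eq_bigr => j _; rewrite mxE.
apply: continuous_big => [|j _ t]; first exact: add_continuous.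
apply: cvgZr_tmp; first exact: nbhs_filter.
apply: cvg_big => [| |i _]; [exact: add_continuous|exact: nbhs_filter|].
exact: coord_continuous.
Qed.

Lemma simplex_map_continuous : continuous simplex_map.
Proof.
apply/continuous_comp_initial => t.
apply: (@continuous_comp (simplex n) _ _ set_val simplex_map_row t).
  exact: initial_continuous.
exact: simplex_map_row_continuous.
Qed.

HB.instance Definition _ :=
  isContinuous.Build (simplex n) (simplex m) simplex_map simplex_map_continuous.
End SimplexMap.

Lemma simplex_map_comp n m k (f : 'I_n.+1 -> 'I_m.+1) (g : 'I_m.+1 -> 'I_k.+1) :
  simplex_map g \o simplex_map f =1 simplex_map (g \o f).
Proof.
move=> t; apply: val_inj; apply/rowP => l; rewrite !mxE /=.
rewrite [RHS](partition_big f (fun j => g j == l)) //=.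
apply: eq_bigr => j gj; rewrite mxE; apply: eq_bigl => i.
by case: eqP => [->|]; rewrite ?gj ?andbF.
Qed.

Lemma simplex_map_ext n m (f g : 'I_n.+1 -> 'I_m.+1) :
  f =1 g -> simplex_map f =1 simplex_map g.
Proof.
move=> fg t; apply: val_inj; apply/rowP => l; rewrite !mxE.
by apply: eq_bigl => i; rewrite fg.
Qed.

Section SingularComplex.
Variable T : topologicalType.

Definition sing n : choiceType := continuousType (simplex n) T.

Definition face n (j : 'I_n.+2) (s : sing n.+1) : sing n :=
  s \o simplex_map (lift j).

Lemma face_face n (i j : 'I_n.+2) (s : sing n.+2) : (i <= j)%N ->
  face i (face (lift ord0 j) s) = face j (face (widen_ord (leqnSn _) i) s).
Proof.
move=> ij; apply/continuousEP => t /=; congr (s _).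
rewrite [LHS](simplex_map_comp (lift i) (lift (lift ord0 j)) t).
rewrite [RHS](simplex_map_comp (lift j) (lift (widen_ord (leqnSn _) i)) t).
apply: simplex_map_ext => k.
by apply: val_inj; rewrite /= bump_bump.
Qed.

Definition sing_bd n : {additive {freeg (sing n.+1)} -> {freeg (sing n)}} :=
  free_map (fun s => \sum_(j < n.+2) (-1) ^+ j *: << face j s >>).

Lemma sing_bdU n (s : sing n.+1) :
  sing_bd n << s >> = \sum_(j < n.+2) (-1) ^+ j *: << face j s >>.
Proof. exact: free_mapU. Qed.

Lemma sing_bd_bd n x : sing_bd n (sing_bd n.+1 x) = 0.
Proof.
suff e : (sing_bd n \o sing_bd n.+1 : {additive _ -> _}) =1
    (\0 : {additive {freeg (sing n.+2)} -> {freeg (sing n)}}) by exact: e.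
apply: free_map_ext => s; rewrite /= sing_bdU raddf_sum /=.
rewrite -[RHS](@alternating_sum_sq _ _ (fun j i => << face i (face j s) >>)).
  apply: eq_bigr => j _; rewrite additiveZ sing_bdU scaler_sumr.
  by apply: eq_bigr => i _; rewrite scalerA exprD.
by move=> i j ij; rewrite face_face.
Qed.

Definition singular_complex : chain_complex := ChainComplex sing_bd_bd.
End SingularComplex.

Section SingularMap.
Variables (T U : topologicalType) (f : continuousType T U).

Definition sing_push n (s : sing T n) : sing U n := f \o s.

Definition sing_map n : {additive {freeg (sing T n)} -> {freeg (sing U n)}} :=
  free_map (fun s => << sing_push s >>).

Lemma sing_mapU n (s : sing T n) : sing_map n << s >> = << sing_push s >>.
Proof. exact: free_mapU. Qed.

Lemma sing_map_bd n x : sing_bd U n (sing_map n.+1 x) = sing_map n (sing_bd T n x).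
Proof.
suff e : (sing_bd U n \o sing_map n.+1 : {additive _ -> _}) =1
    (sing_map n \o sing_bd T n : {additive _ -> _}) by exact: e.
apply: free_map_ext => s; rewrite /= sing_mapU !sing_bdU raddf_sum.
apply: eq_bigr => j _; rewrite additiveZ sing_mapU; congr (_ *: << _ >>).
exact/continuousEP.
Qed.

Definition singular_map :
    chain_map (singular_complex T) (singular_complex U) :=
  @ChainMap (singular_complex T) (singular_complex U) sing_map sing_map_bd.
End SingularMap.

Definition singular_homology (T : topologicalType) (n : nat) : zmodType :=
  homology (singular_complex T) n.

Definition one_point : topologicalType := discrete_topology unit.

Definition to_point (T : topologicalType) : continuousType T one_point :=
  cst (tt : one_point).

Definition reduced_homology (T : topologicalType) (n : nat) : zmodType :=
  subgroup (kernel_of (homology_map (singular_map (to_point T)) n)).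
End Singular.

Section HomotopyOrbits.
Variables (R : realType) (X : choiceType) (phi : X -> X).
Hypothesis phi_bij : bijective phi.

Lemma perm_inv_subproof : exists psi, cancel phi psi /\ cancel psi phi.
Proof. by case: phi_bij => psi; exists psi. Qed.

Definition perm_inv : X -> X := sval (cid perm_inv_subproof).

Lemma permK : cancel phi perm_inv.
Proof. by rewrite /perm_inv; case: cid => psi []. Qed.

Lemma perm_invK : cancel perm_inv phi.
Proof. by rewrite /perm_inv; case: cid => psi []. Qed.

Definition perm_pow (n : int) (x : X) : X :=
  match n with
  | Posz m => iter m phi x
  | Negz m => iter m.+1 perm_inv x
  end.

Lemma perm_powD1 n x : perm_pow (n + 1) x = phi (perm_pow n x).
Proof.
case: n => [n|[|n]]; first by rewrite -PoszD addn1.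
  by rewrite /= perm_invK.
have -> : Negz n.+1 + 1 = Negz n by lia.
by rewrite [in RHS]/perm_pow iterS perm_invK.
Qed.

Lemma perm_powB1 n x : perm_pow (n - 1) x = perm_inv (perm_pow n x).
Proof. by rewrite -{2}(subrK 1 n) perm_powD1 permK. Qed.

Lemma perm_powD m n x : perm_pow (m + n) x = perm_pow m (perm_pow n x).
Proof.
elim: m => [|m IH|m IH]; first by rewrite add0r.
  by rewrite -addn1 PoszD -addrA (addrC 1) addrA !perm_powD1 IH.
by rewrite -addn1 PoszD opprD -addrA (addrC (- 1)) addrA !perm_powB1 IH.
Qed.

(* The contractible free Z-space E Z is modelled by the real line with Z acting
   by translations, so that the orbit space of the diagonal action is also the
   mapping torus of [phi]. *)
Definition EZ_times : topologicalType := (R * discrete_topology X)%type.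

Definition orbit_rel (a b : EZ_times) : bool :=
  `[< exists n : int, b.1 = a.1 + n%:~R /\ b.2 = perm_pow n a.2 >].

Lemma orbit_rel_equiv : equiv_class_of orbit_rel.
Proof.
split=> [[s x]|[s x] [t y]|[t y] [s x] [u z]].
- by apply/asboolP; exists 0; rewrite addr0.
- apply/idP/idP => /asboolP[n /= [-> ->]]; apply/asboolP; exists (- n) => /=.
    by rewrite -perm_powD addNr rmorphN addrK.
  by rewrite -perm_powD addNr rmorphN addrK.
- move=> /asboolP[n /= [-> ->]] /asboolP[m /= [-> ->]].
  apply/asboolP; exists (m + n) => /=.
  by rewrite perm_powD rmorphD addrA addrAC.
Qed.

Canonical orbit_rel_equiv_rel := EquivRelPack orbit_rel_equiv.

Definition homotopy_orbits : topologicalType :=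
  quotient_topology {eq_quot orbit_rel}.
End HomotopyOrbits.

Record rack := Rack {
  rack_set :> choiceType;
  rack_op : rack_set -> rack_set -> rack_set;
  rack_op_bij : forall x, bijective (rack_op x);
  rack_opDl : forall x y z,
    rack_op x (rack_op y z) = rack_op (rack_op x y) (rack_op x z)
}.

Definition permutation_rack (X : choiceType) (phi : X -> X)
    (phi_bij : bijective phi) : rack :=
  @Rack X (fun _ y => phi y) (fun _ => phi_bij) (fun _ _ _ => erefl).

Section RackComplex.
Variable X : rack.

Definition word n : choiceType := {ffun 'I_n -> X}.

Definition rack_face0 n (k : 'I_n.+1) (x : word n.+1) : word n :=
  [ffun i => x (lift k i)].

Definition rack_face1 n (k : 'I_n.+1) (x : word n.+1) : word n :=
  [ffun i : 'I_n => if (i < k)%N then x (lift k i)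
                    else rack_op (x k) (x (lift k i))].

(* On words of length [n.+1], the index [k = n] is omitted: there both faces
   agree. *)
Definition rack_bd n : {additive {freeg (word n.+1)} -> {freeg (word n)}} :=
  free_map (fun x => \sum_(k < n) (-1) ^+ k *:
    (<< rack_face0 (widen_ord (leqnSn n) k) x >>
     - << rack_face1 (widen_ord (leqnSn n) k) x >>)).

Lemma rack_bdU n (x : word n.+1) :
  rack_bd n << x >> = \sum_(k < n.+1) (-1) ^+ k *:
    (<< rack_face0 k x >> - << rack_face1 k x >>).
Proof.
rewrite big_ord_recr /=.
rewrite (_ : rack_face1 ord_max x = rack_face0 ord_max x) ?subrr ?scaler0 ?addr0.
  exact: free_mapU.
by apply/ffunP => i; rewrite !ffunE ltn_ord.
Qed.

Section Faces.
Variables (n : nat) (i j : 'I_n.+1) (x : word n.+2).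
Hypothesis ij : (i <= j)%N.
Let i' := widen_ord (leqnSn n.+1) i.
Let j' := lift ord0 j : 'I_n.+2.

Let liftE k : lift j' (lift i k) = lift i' (lift j k).
Proof. by apply: val_inj; rewrite /= bump_bump. Qed.

Let lift_i : lift j' i = i'.
Proof. by apply: val_inj; rewrite /= /bump /= add1n ltnNge ij. Qed.

Let lift_j : lift i' j = j'.
Proof. by apply: val_inj; rewrite /= /bump /= ij. Qed.

Lemma rack_face00 :
  rack_face0 i (rack_face0 j' x) = rack_face0 j (rack_face0 i' x).
Proof. by apply/ffunP => k; rewrite !ffunE liftE. Qed.

Lemma rack_face01 :
  rack_face0 i (rack_face1 j' x) = rack_face1 j (rack_face0 i' x).
Proof.
apply/ffunP => k; rewrite !ffunE liftE lift_j; congr (if _ then _ else _).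
by rewrite /= /bump /= add1n ltnS; case: (leqP i k) => // /leq_trans/(_ ij) ik;
  rewrite add0n [LHS]ltnW.
Qed.

Lemma rack_face10 :
  rack_face1 i (rack_face0 j' x) = rack_face0 j (rack_face1 i' x).
Proof.
apply/ffunP => k; rewrite !ffunE liftE lift_i; congr (if _ then _ else _).
rewrite /= /bump /=; case: (leqP j k) => // jk.
by rewrite add1n !ltnNge leqW ?(leq_trans ij jk).
Qed.

Lemma rack_face11 :
  rack_face1 i (rack_face1 j' x) = rack_face1 j (rack_face1 i' x).
Proof.
apply/ffunP => k; rewrite !ffunE liftE lift_i lift_j /= /bump /= add1n.
rewrite !ltnS ij [(j < i)%N]ltnNge ij /=.
case: (leqP i k) => ik; case: (leqP j k) => jk /=; rewrite ?add1n ?add0n.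
- by rewrite [(k.+1 < i)%N]ltnNge (leq_trans ik) ?leqW //= rack_opDl.
- by rewrite [(k < i)%N]ltnNge ik.
- by move: (leq_ltn_trans (leq_trans ij jk) ik); rewrite ltnn.
- by rewrite ltnW // ?(leq_trans ik).
Qed.
End Faces.

Lemma rack_bd_bd n x : rack_bd n (rack_bd n.+1 x) = 0.
Proof.
suff e : (rack_bd n \o rack_bd n.+1 : {additive _ -> _}) =1
    (\0 : {additive {freeg (word n.+2)} -> {freeg (word n)}}) by exact: e.
apply: free_map_ext => w; rewrite /= rack_bdU raddf_sum /=.
rewrite -[RHS](@alternating_sum_sq _ _ (fun j i =>
    (<< rack_face0 i (rack_face0 j w) >> - << rack_face1 i (rack_face0 j w) >>)
  - (<< rack_face0 i (rack_face1 j w) >> - << rack_face1 i (rack_face1 j w) >>))).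
  apply: eq_bigr => j _; rewrite additiveZ (raddfB (rack_bd n)) !rack_bdU -sumrB scaler_sumr.
  by apply: eq_bigr => i _; rewrite -scalerBr scalerA exprD.
move=> i j ij; rewrite rack_face00 // rack_face01 // rack_face10 // rack_face11 //.
by rewrite !opprD !opprK addrACA.
Qed.

Definition rack_complex : chain_complex := ChainComplex rack_bd_bd.

Definition rack_homology (n : nat) : zmodType := homology rack_complex n.
End RackComplex.

(* A spectral sequence of homological type starting with the page [a]; the
   values at [r < a] are irrelevant.  To avoid casts, a differential is given by
   components between arbitrary bidegrees, which vanish unless they are of
   bidegree (-r, r - 1). *)
Record spectral_sequence (a : nat) := SpectralSequence {
  page : nat -> int -> int -> zmodType;
  dif : forall (r : nat) (p q p' q' : int), {additive page r p q -> page r p' q'};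
  dif_degree : forall (r : nat) p q p' q' x, (a <= r)%N ->
    dif r p q p' q' x != 0 -> p' = p - r%:Z /\ q' = q + r%:Z - 1;
  dif_dif : forall (r : nat) p q p' q' p'' q'' x, (a <= r)%N ->
    dif r p' q' p'' q'' (dif r p q p' q' x) = 0;
  next_page : forall (r : nat) p q, (a <= r)%N ->
    zmod_iso
      (subquotient (kernel_of (dif r p q (p - r%:Z) (q + r%:Z - 1)))
                   (image_of (dif r (p + r%:Z) (q - r%:Z + 1) p q)))
      (page r.+1 p q)
}.

Definition degenerate (a : nat) (E : spectral_sequence a) : Prop :=
  forall (r : nat) p q p' q' x, (a <= r)%N -> dif E r p q p' q' x = 0.

(* [G] is the stable value of the groups [page E r p q]: once the differentials
   out of and into (p, q) vanish, these are all isomorphic by [next_page]. *)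
Definition is_Einfty (a : nat) (E : spectral_sequence a) (p q : int)
    (G : zmodType) : Prop :=
  exists2 r0 : nat, (a <= r0)%N & forall r : nat, (r0 <= r)%N ->
    [/\ forall p' q' x, dif E r p q p' q' x = 0,
        forall p' q' x, dif E r p' q' p q x = 0
      & isomorphic (page E r p q) G].

Definition abuts_to (a : nat) (E : spectral_sequence a) (H : int -> zmodType)
    : Prop :=
  forall n : int, exists F : int -> zmodClosed (H n),
    [/\ forall p, {subset F (p - 1) <= F p},
        exists s, forall x, x \in F s -> x = 0,
        exists t, forall x, x \in F t
      & forall p, is_Einfty E p (n - p) (subquotient (F p) (F (p - 1)))].

Section SecondPage.
Variables (R : realType) (T : topologicalType).

Definition E2_row (q : nat) : nat -> zmodType :=
  if q is m.+1 then
    graded_tensor (graded_power (reduced_homology R T) m) (singular_homology R T)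
  else graded_unit.

Definition E2_page (p q : int) : zmodType :=
  nonneg (fun m => nonneg (E2_row m) p) q.
End SecondPage.

(* Main.v *)
(** The homotopy orbit space Y is covered by R * X, a space whose components are
contractible, with deck group Z generated by t; so H_*(Y) is computed by the exact
sequence 0 -> C(R * X) -(1 - t)-> C(R * X) -> C(Y) -> 0, and is the homology of
the two-term complex 1 - phi : ZX -> ZX.  It is free: H_0 on the orbits of phi,
H_1 on the finite orbits.

On the rack side, let lam_x be the left multiplication of words by x.  Then
d lam_x + lam_x d = 1 - phi, so that lam_a anticommutes with d for a in the kernel
A' of the augmentation of A = ZX.  With mu_x = lam_x0 lam_x + lam_(phi x - x0) lam_x0
one has C_(n+2) = lam_A' C_(n+1) + mu_A C_n (a direct sum) and
d mu_x = lam_(x - phi x) + mu_x d.  Hence the rack complex is T(M) tensored with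
Z + Z[1], where M is the two-term complex 1 - phi : A -> A' in degrees 2 and 1, the
homology of which is the shifted reduced homology of Y.  An explicit homotopy
retraction of A -> A' onto its homology extends to the whole rack complex and
identifies its homology with the sum of the groups on the second page; all the
groups are free, so it is enough to match bases. *)

From HB Require Import structures.
From mathcomp Require Import zify freeg.
From mathcomp Require Import all_boot all_order all_algebra ssrAC.
From mathcomp Require Import generic_quotient ring_quotient.
From mathcomp Require Import all_classical all_reals topology normedtype.
From mathcomp Require Import lra interval_inference.
Require Import Defs.

Set Implicit Arguments.
Unset Strict Implicit.
Unset Printing Implicit Defensive.

Import Order.TTheory GRing.Theory Num.Theory.
Import numFieldNormedType.Exports.

Local Open Scope ring_scope.
Local Open Scope quotient_scope.

(** * Additive relations, tensor products and free groups *)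

(** The pages can be taken constant with zero differentials, so the content is that HR_n has a
    filtration with subquotients E2_(p, n-p). Since every group involved is free, neither a Künneth
    theorem nor an extension problem comes in: a basis of HR_n by words, graded by the number p of
    letters of length 2, yields the filtration. A letter of length 1 has degree 0 and one of length
    2 has degree 1, so q = n - p counts letters, that is, tensor factors; this is why the row index
    appears as the number of factors. The last factor is unreduced because in degree 1 of the rack
    complex every chain is a cycle and no augmentation has been divided out. The whole description
    of the rack complex depends on a base point [x0]. It is taken to be the chosen representative of
    an orbit, so that the retraction of X onto orbit representatives fixes it; for empty X it does
    not exist, and that case is treated apart. On the topological side, evenly covered
    neighbourhoods are replaced by the flow on Y that translates the real coordinate. *)

Lemma additive_of (U V : zmodType) (f : U -> V) :
  zmod_morphism f -> {F : {additive U -> V} | F =1 f}.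
Proof.
move=> fB; pose B := GRing.isZmodMorphism.Build U V f fB.
by pose F : {additive U -> V} := HB.pack f B; exists F.
Qed.

Lemma isomorphic_can (U V : zmodType) (f : {additive U -> V}) (g : V -> U) :
  cancel f g -> cancel g f -> isomorphic U V.
Proof. by move=> fK gK; split; exists f; exists g. Qed.

Lemma isomorphic_refl (U : zmodType) : isomorphic U U.
Proof. exact: (@isomorphic_can U U idfun id). Qed.

Lemma isomorphic_sym (U V : zmodType) : isomorphic U V -> isomorphic V U.
Proof.
move=> [[f [g fK gK]]]; have gB : zmod_morphism g.
  by move=> x y; apply: (can_inj fK); rewrite raddfB !gK.
have [G Gg] := additive_of gB.
by apply: (@isomorphic_can V U G f) => x; rewrite Gg.
Qed.

Lemma isomorphic_trans (V U W : zmodType) :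
  isomorphic U V -> isomorphic V W -> isomorphic U W.
Proof.
move=> [[f fb]] [[g gb]]; split; exists (g \o f : {additive U -> W}).
exact: bij_comp gb fb.
Qed.

(* An additive relation that is total, surjective and faithful at 0 on both
   sides; this is how a diagram chase defines an isomorphism. *)
Lemma bijective_rel (U V : zmodType) (rho : U -> V -> Prop) :
  (forall u v u' v', rho u v -> rho u' v' -> rho (u - u') (v - v')) ->
  (forall u, exists v, rho u v) -> (forall v, exists u, rho u v) ->
  (forall v, rho 0 v -> v = 0) -> (forall u, rho u 0 -> u = 0) ->
  exists2 F : {additive U -> V}, bijective F & forall u, rho u (F u).
Proof.
move=> rhoB tot surj fun0 inj0.
pose f u := sval (cid (tot u)); have fP u : rho u (f u) by rewrite /f; case: cid.
pose g v := sval (cid (surj v)); have gP v : rho (g v) v by rewrite /g; case: cid.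
have fE u v : rho u v -> f u = v.
  move=> uv; apply/eqP; rewrite -subr_eq0; apply/eqP/fun0.
  by rewrite -(subrr u); apply: rhoB.
have [F Ff] : {F : {additive U -> V} | F =1 f}.
  by apply: additive_of => x y; apply: fE; apply: rhoB.
exists F => [|u]; last by rewrite Ff.
exists g => [u|v]; rewrite Ff; last exact: fE.
apply/eqP; rewrite -subr_eq0; apply/eqP/inj0.
by rewrite -(subrr (f u)); apply: rhoB.
Qed.

Lemma isomorphic_rel (U V : zmodType) (rho : U -> V -> Prop) :
  (forall u v u' v', rho u v -> rho u' v' -> rho (u - u') (v - v')) ->
  (forall u, exists v, rho u v) -> (forall v, exists u, rho u v) ->
  (forall v, rho 0 v -> v = 0) -> (forall u, rho u 0 -> u = 0) ->
  isomorphic U V.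
Proof.
move=> rhoB tot surj fun0 inj0.
by have [F Fb _] := bijective_rel rhoB tot surj fun0 inj0; split; exists F.
Qed.

Lemma subquotient_class_eq0 (V : zmodType) (A B : zmodClosed V) x (Ax : x \in A) :
  subquotient_class B Ax = 0 <-> x \in B.
Proof.
rewrite -(raddf0 \pi_(subquotient A B)).
have -> : (x \in B) = (subquotient_class B Ax == \pi_(subquotient A B) 0).
  by rewrite -Quotient.idealrBE inE subr0.
by split => /eqP.
Qed.

(** The relation is stated on representatives, as a diagram chase produces it. The last clause holds
    for every representative, not just for one chosen by the construction; this lets further
    invariants, such as degrees, be read off. *)
Lemma bijective_subquotient (V W : zmodType) (A B : zmodClosed V)
    (rho : V -> W -> Prop) :
  {subset B <= A} ->
  (forall u v u' v', rho u v -> rho u' v' -> rho (u - u') (v - v')) ->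
  (forall u, u \in A -> exists v, rho u v) ->
  (forall v, exists2 u, u \in A & rho u v) ->
  (forall u v, u \in B -> rho u v -> v = 0) ->
  (forall u, u \in A -> rho u 0 -> u \in B) ->
  exists2 F : {additive subquotient A B -> W}, bijective F &
    forall x (Ax : x \in A), rho x (F (subquotient_class B Ax)).
Proof.
move=> BA rhoB tot surj fun0 inj0.
have [|||||F Fb FP] := @bijective_rel (subquotient A B) W (fun c w =>
    exists x (Ax : x \in A), c = subquotient_class B Ax /\ rho x w).
- move=> _ w _ w' [x [Ax [-> xw]]] [y [Ay [-> yw']]].
  by exists (x - y), (rpredB Ax Ay); rewrite subquotient_classB; split => //; apply: rhoB.
- move=> c; have [x [Ax ->]] := subquotient_classP c; have [w xw] := tot x Ax.
  by exists w, x, Ax.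
- move=> w; have [x Ax xw] := surj w.
  by exists (subquotient_class B Ax), x, Ax.
- move=> w [x [Ax [/esym/subquotient_class_eq0 Bx xw]]]; exact: fun0 xw.
- by move=> _ [x [Ax [-> x0]]]; apply/subquotient_class_eq0; apply: inj0.
(* The chase relates only some representative y to the value. Since x - y lies in B it is related to
   0, and adding this to the relation for y gives the one for x. *)
exists F => // x Ax; have [y [Ay [xy yF]]] := FP (subquotient_class B Ax).
have Bxy : x - y \in B.
  apply/(subquotient_class_eq0 _ (rpredB Ax Ay)).
  by rewrite subquotient_classB xy subrr.
have [w xyw] := tot _ (BA _ Bxy); have w0 := fun0 _ _ Bxy xyw.
have y0 := rhoB _ _ _ _ yF yF; rewrite !subrr in y0.
have := rhoB _ _ _ _ xyw (rhoB _ _ _ _ y0 yF).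
by rewrite w0 !sub0r !opprK subrK.
Qed.

Lemma isomorphic_subquotient (V W : zmodType) (A B : zmodClosed V)
    (rho : V -> W -> Prop) :
  {subset B <= A} ->
  (forall u v u' v', rho u v -> rho u' v' -> rho (u - u') (v - v')) ->
  (forall u, u \in A -> exists v, rho u v) ->
  (forall v, exists2 u, u \in A & rho u v) ->
  (forall u v, u \in B -> rho u v -> v = 0) ->
  (forall u, u \in A -> rho u 0 -> u \in B) ->
  isomorphic (subquotient A B) W.
Proof.
move=> BA rhoB tot surj fun0 inj0.
by have [F Fb _] := bijective_subquotient BA rhoB tot surj fun0 inj0; split; exists F.
Qed.

(** Bare functions with a proof of additivity allow composites, differences and partial applications
    to be compared on generators without a bundled structure for each of them. *)
Lemma freeg_ext (K : choiceType) (V : zmodType) (f g : {freeg K} -> V) :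
  zmod_morphism f -> zmod_morphism g -> (forall k, f << k >> = g << k >>) -> f =1 g.
Proof.
move=> /additive_of[F FE] /additive_of[G GE] fg x.
by rewrite -FE -GE; apply: free_map_ext => k; rewrite FE GE.
Qed.

Definition equinumerous (K L : Type) : Prop := exists f : K -> L, bijective f.

Lemma isomorphic_freeg (K L : choiceType) :
  equinumerous K L -> isomorphic {freeg K} {freeg L}.
Proof.
move=> [f [g fK gK]].
apply: (@isomorphic_can _ _ (free_map (fun k => << f k >>) : {additive {freeg K} -> {freeg L}})
  (free_map (fun l => << g l >>))).
    by apply: freeg_ext => [x y|//|k]; rewrite ?raddfB //= !free_mapU fK.
by apply: freeg_ext => [x y|//|k]; rewrite ?raddfB //= !free_mapU gK.
Qed.

Lemma isomorphic_trivial (U V : zmodType) :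
  (forall u : U, u = 0) -> (forall v : V, v = 0) -> isomorphic U V.
Proof.
move=> U0 V0; apply: (@isomorphic_can U V \0 (fun=> 0)) => x; first by rewrite [RHS]U0.
by rewrite [RHS]V0.
Qed.

Lemma zmod0_eq0 (x : zmod0) : x = 0.
Proof. by apply/rowP => -[]. Qed.

Lemma freeg_empty (K : choiceType) (D : {freeg K}) : (K -> False) -> D = 0.
Proof. by move=> K0; apply/eqP/freeg_eqP => k; case: (K0 k). Qed.

Lemma zmod0_freeg (K : choiceType) : (K -> False) -> isomorphic zmod0 {freeg K}.
Proof.
move=> K0; apply: isomorphic_trivial => [|D]; first exact: zmod0_eq0.
exact: freeg_empty.
Qed.

Lemma int_freeg_unique (K : choiceType) (k : K) :
  (forall l, l = k) -> isomorphic int {freeg K}.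
Proof.
move=> kP; apply: isomorphic_sym.
apply: (@isomorphic_can _ _ (free_map (fun _ : K => 1%Z)) (fun n => << k >> *~ n)).
  apply: freeg_ext => [x y|//|l]; first by rewrite raddfB mulrzBr.
  by rewrite /= free_mapU (kP l).
by move=> n; rewrite raddfMz /= free_mapU intz.
Qed.

Lemma freeg_sum (K L : choiceType) :
  isomorphic ({freeg K} * {freeg L})%type {freeg (K + L)%type}.
Proof.
apply: isomorphic_sym.
pose f := free_map (fun s : K + L => match s with
   | inl k => (<< k >>, 0) | inr l => (0, << l >>) end : {freeg K} * {freeg L}).
pose g (c : {freeg K} * {freeg L}) : {freeg (K + L)%type} :=
  free_map (fun k => << inl k >>) c.1 + free_map (fun l => << inr l >>) c.2.
have fB : zmod_morphism f by exact: raddfB.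
have gB : zmod_morphism g by move=> x y; rewrite /g !raddfB /= addrACA opprD.
apply: (@isomorphic_can _ _ f g) => [c|[c d]].
  move: c; apply: freeg_ext => [x y|//|]; first by rewrite raddfB gB.
  by case=> x /=; rewrite free_mapU /g /= free_mapU raddf0 ?addr0 ?add0r.
transitivity (f (free_map (fun k => << inl k >>) c) + f (free_map (fun l => << inr l >>) d)).
  exact: raddfD.
have -> : f (free_map (fun k => << inl k >>) c) = (c, 0).
  move: c; apply: freeg_ext => [x y|x y|k]; first by rewrite raddfB fB.
    by congr (_, _); rewrite subr0.
  by rewrite free_mapU /f free_mapU.
have -> : f (free_map (fun k => << inr k >>) d) = (0, d).
  move: d; apply: freeg_ext => [x y|x y|k]; first by rewrite raddfB fB.
    by congr (_, _); rewrite subr0.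
  by rewrite free_mapU /f free_mapU.
by congr (_, _); rewrite ?addr0 ?add0r.
Qed.

Lemma isomorphic_prod (U V U' V' : zmodType) :
  isomorphic U U' -> isomorphic V V' -> isomorphic (U * V)%type (U' * V')%type.
Proof.
move=> [[f [f' fK f'K]]] [[g [g' gK g'K]]].
have [F FE] := @additive_of (U * V)%type (U' * V')%type (fun c => (f c.1, g c.2))
  ltac:(by move=> x y; congr (_, _); rewrite raddfB).
apply: (@isomorphic_can _ _ F (fun c => (f' c.1, g' c.2))) => -[a b] /=.
  by rewrite FE /= fK gK.
by rewrite FE /= f'K g'K.
Qed.

Section Tensor.
Variables (A B : zmodType).

Definition pure (a : A) (b : B) : tensor A B := \pi_(tensor A B) << (a, b) >>.

Lemma pureBl a a' b : pure (a - a') b = pure a b - pure a' b.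
Proof.
apply/eqP; rewrite eq_sym -raddfB -Quotient.idealrBE.
apply/asboolP => G GS.
have := GS _ (or_introl (ex_intro _ (a - a') (ex_intro _ a' (ex_intro _ b erefl)))).
by rewrite subrK addrAC.
Qed.

Lemma pureBr a b b' : pure a (b - b') = pure a b - pure a b'.
Proof.
apply/eqP; rewrite eq_sym -raddfB -Quotient.idealrBE.
apply/asboolP => G GS.
have := GS _ (or_intror (ex_intro _ a (ex_intro _ (b - b') (ex_intro _ b' erefl)))).
by rewrite subrK addrAC.
Qed.

Lemma tensor_rec (V : zmodType) (f : A -> B -> V) :
  (forall b, zmod_morphism (f^~ b)) -> (forall a, zmod_morphism (f a)) ->
  {F : {additive tensor A B -> V} | forall a b, F (pure a b) = f a b}.
Proof.
move=> fl fr; pose F0 := free_map (fun c => f c.1 c.2).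
have F0B : zmod_morphism F0 by exact: raddfB.
have F00 x : x \in (generated (V := {freeg (A * B)%type})
    ([set s | exists a a' b, s = << (a + a', b) >> - << (a, b) >> - << (a', b) >>]
 `|` [set s | exists a b b', s = << (a, b + b') >> - << (a, b) >> - << (a, b') >>]))%classic ->
   F0 x = 0.
  (* The kernel of [F0] is one of the subgroups over which [generated] quantifies, so only the two
     kinds of defining relations have to be checked. *)
  move=> /asboolP/(_ (kernel_of F0)) H; apply/eqP; apply: H => s [] [a [b [c ->]]];
  rewrite inE !raddfB /= !free_mapU /=.
    have := fl c (a + b) b; rewrite addrK => ->.
    by rewrite opprB addrCA subrr addr0 subrr.
  have := fr a (b + c) c; rewrite addrK => ->.
  by rewrite opprB addrCA subrr addr0 subrr.
pose F (c : tensor A B) := F0 (repr c).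
have FE x : F (\pi x) = F0 x.
  apply/eqP; rewrite -subr_eq0 -F0B F00 //.
  by rewrite (Quotient.idealrBE) reprK.
have [G GF] : {G : {additive tensor A B -> V} | G =1 F}.
  apply: additive_of => x y; rewrite -[x in LHS]reprK -[y in LHS]reprK.
  by rewrite -raddfB FE F0B.
by exists G => a b; rewrite GF FE /F0 free_mapU.
Qed.

Lemma tensor_ext (V : zmodType) (f g : tensor A B -> V) :
  zmod_morphism f -> zmod_morphism g ->
  (forall a b, f (pure a b) = g (pure a b)) -> f =1 g.
Proof.
move=> fB gB fg x; rewrite -[x]reprK.
move: (repr x); apply: freeg_ext => [u v|u v|[a b]]; last exact: fg.
  by rewrite raddfB fB.
by rewrite raddfB gB.
Qed.
End Tensor.

Lemma isomorphic_tensor (A B A' B' : zmodType) :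
  isomorphic A A' -> isomorphic B B' -> isomorphic (tensor A B) (tensor A' B').
Proof.
move=> [[f [f' fK f'K]]] [[g [g' gK g'K]]].
have f'B : zmod_morphism f' by move=> x y; apply: (can_inj fK); rewrite raddfB !f'K.
have g'B : zmod_morphism g' by move=> x y; apply: (can_inj gK); rewrite raddfB !g'K.
have [F FE] := @tensor_rec A B (tensor A' B') (fun a b => pure (f a) (g b))
  ltac:(by move=> b x y; rewrite raddfB pureBl) ltac:(by move=> b x y; rewrite raddfB pureBr).
have [G GE] := @tensor_rec A' B' (tensor A B) (fun a b => pure (f' a) (g' b))
  ltac:(by move=> b x y; rewrite f'B pureBl) ltac:(by move=> b x y; rewrite g'B pureBr).
apply: (@isomorphic_can _ _ F G).
  by apply: tensor_ext => [x y|//|a b]; rewrite ?raddfB // FE GE fK gK.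
by apply: tensor_ext => [x y|//|a b]; rewrite ?raddfB // GE FE f'K g'K.
Qed.

Definition free_map2 (K L : choiceType) (V : zmodType) (f : K -> L -> V)
    (c : {freeg K}) (d : {freeg L}) : V :=
  free_map (fun k => free_map (f k) d) c.

Section FreeMap2.
Variables (K L : choiceType) (V : zmodType) (f : K -> L -> V).

Lemma free_map2U k l : free_map2 f << k >> << l >> = f k l.
Proof. by rewrite /free_map2 !free_mapU. Qed.

Lemma free_map2Ul k d : free_map2 f << k >> d = free_map (f k) d.
Proof. by rewrite /free_map2 free_mapU. Qed.

Lemma free_map2Bl d : zmod_morphism ((free_map2 f)^~ d).
Proof. by move=> x y; rewrite /free_map2 raddfB. Qed.

Lemma free_map2Br c : zmod_morphism (free_map2 f c).
Proof.
move=> x y; move: c; apply: freeg_ext => [u v|u v|k]; rewrite ?free_map2Bl //.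
  by rewrite !opprD !opprK addrACA.
by rewrite !free_map2Ul raddfB.
Qed.

HB.instance Definition _ c :=
  GRing.isZmodMorphism.Build {freeg L} V (free_map2 f c) (free_map2Br c).
End FreeMap2.

Lemma tensor_freeg (K L : choiceType) :
  isomorphic (tensor {freeg K} {freeg L}) {freeg (K * L)%type}.
Proof.
have [F FE] := @tensor_rec {freeg K} {freeg L} {freeg (K * L)%type}
  (free_map2 (fun k l => << (k, l) >>)) (free_map2Bl _) (free_map2Br _).
pose G := free_map (fun x : K * L => pure << x.1 >> << x.2 >> : tensor {freeg K} {freeg L}).
have GB : zmod_morphism G by exact: raddfB.
apply: (@isomorphic_can _ _ F G); last first.
  apply: freeg_ext => [x y|//|[k l]]; first by rewrite GB raddfB.
  by rewrite /G free_mapU FE free_map2U.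
apply: tensor_ext => [x y|//|a b]; first by rewrite raddfB GB.
rewrite FE; move: a; apply: freeg_ext => [x y|x y|k].
- by rewrite free_map2Bl GB.
- exact: pureBl.
- move: b; apply: freeg_ext => [x y|x y|l]; first by rewrite raddfB GB.
    exact: pureBr.
  by rewrite free_map2U /G free_mapU.
Qed.

(** * Bijections between bases and the combinatorics of words *)

Lemma equinumerous_trans (K L M : Type) :
  equinumerous K L -> equinumerous L M -> equinumerous K M.
Proof. by move=> [f fb] [g gb]; exists (g \o f); apply: bij_comp. Qed.

Lemma equinumerous_sum (K L K' L' : Type) :
  equinumerous K K' -> equinumerous L L' -> equinumerous (K + L) (K' + L').
Proof.
move=> [f [f' fK f'K]] [g [g' gK g'K]].
exists (fun s => match s with inl k => inl (f k) | inr l => inr (g l) end).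
exists (fun s => match s with inl k => inl (f' k) | inr l => inr (g' l) end);
  by case=> x; rewrite ?fK ?gK ?f'K ?g'K.
Qed.

Lemma equinumerous_prod (K L K' L' : Type) :
  equinumerous K K' -> equinumerous L L' -> equinumerous (K * L) (K' * L').
Proof.
move=> [f [f' fK f'K]] [g [g' gK g'K]].
exists (fun s => (f s.1, g s.2)).
by exists (fun s => (f' s.1, g' s.2)); case=> x y; rewrite /= ?fK ?gK ?f'K ?g'K.
Qed.

Lemma equinumerous_refl (K : Type) : equinumerous K K.
Proof. by exists id; exists id. Qed.

Lemma equinumerous_empty (K L : Type) :
  (K -> False) -> (L -> False) -> equinumerous K L.
Proof.
move=> K0 L0; exists (fun k => match K0 k with end).
by exists (fun l => match L0 l with end) => x; [case: (K0 x)|case: (L0 x)].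
Qed.

Lemma equinumerous_inl (K L : Type) : (L -> False) -> equinumerous (K + L) K.
Proof.
move=> L0; exists (fun s => match s with inl k => k | inr l => match L0 l with end end).
by exists inl => //; case=> // l; case: (L0 l).
Qed.

Lemma equinumerous_inr (K L : Type) : (K -> False) -> equinumerous (K + L) L.
Proof.
move=> K0; exists (fun s => match s with inr l => l | inl k => match K0 k with end end).
by exists inr => //; case=> // k; case: (K0 k).
Qed.

Lemma equinumerous_sumC (K L : Type) : equinumerous (K + L) (L + K).
Proof.
exists (fun s => match s with inl x => inr x | inr x => inl x end).
by exists (fun s => match s with inl x => inr x | inr x => inl x end); case.
Qed.

Fixpoint disjoint_union (F : nat -> choiceType) (n : nat) : choiceType :=
  if n is m.+1 then (disjoint_union F m + F m)%type else void.

Lemma direct_sum_freeg (A : nat -> zmodType) (F : nat -> choiceType) n :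
  (forall i, isomorphic (A i) {freeg (F i)}) ->
  isomorphic (direct_sum A n) {freeg (disjoint_union F n)}.
Proof.
move=> AF; elim: n => [|n IH] /=; first exact: zmod0_freeg.
by apply: isomorphic_trans (freeg_sum _ _); apply: isomorphic_prod.
Qed.

Lemma graded_tensor_freeg (A B : nat -> zmodType) (F G : nat -> choiceType) p :
  (forall i, isomorphic (A i) {freeg (F i)}) ->
  (forall i, isomorphic (B i) {freeg (G i)}) ->
  isomorphic (graded_tensor A B p)
             {freeg (disjoint_union (fun i => (F i * G (p - i)%N)%type) p.+1)}.
Proof.
move=> AF BG; apply: direct_sum_freeg => i.
by apply: isomorphic_trans (tensor_freeg _ _); apply: isomorphic_tensor.
Qed.

Definition shift (F : nat -> choiceType) (n : nat) : choiceType :=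
  if n is m.+1 then F m else void.

Lemma disjoint_union_empty (F : nat -> choiceType) n :
  (forall i, (i < n)%N -> F i -> False) -> disjoint_union F n -> False.
Proof.
elim: n => [|n IH] F0 //= [/IH|]; last exact: F0.
by apply => i /ltnW; apply: F0.
Qed.

(** For a graded tensor product whose left factor lives in degrees 0 and 1: only the summands i = 0
    and i = 1 survive. *)
Lemma disjoint_union_first2 (F : nat -> choiceType) n :
  (forall i, F i.+2 -> False) ->
  equinumerous (disjoint_union F n.+1) (F 0 + shift (fun=> F 1) n)%type.
Proof.
move=> F0; elim: n => [|n IH] /=; first exact: equinumerous_sumC.
case: n IH => [|n] IH.
  exact: equinumerous_sum (equinumerous_inr _ _) (equinumerous_refl _).
apply: equinumerous_trans (equinumerous_inl _ (F0 n)) _; exact: IH.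
Qed.

(** The mirror case, for a right factor in degrees 0 and 1: only i = n and i = n - 1 survive. *)
Lemma disjoint_union_last2 (F : nat -> choiceType) n :
  (forall i, (i.+1 < n)%N -> F i -> False) ->
  equinumerous (disjoint_union F n.+1) (F n + shift F n)%type.
Proof.
move=> F0 /=; apply: equinumerous_trans (equinumerous_sumC _ _) _.
apply: equinumerous_sum (equinumerous_refl _) _.
case: n F0 => [|n] F0 /=; first exact: equinumerous_refl.
apply: equinumerous_inr; apply: disjoint_union_empty => i; exact: F0.
Qed.

Section Words.
Variables S B0 B1 : choiceType.

(* The words of length n and degree p in letters from B0 (length 1, degree 0) and
   B1 (length 2, degree 1), followed by nothing or by a letter from S, the letters
   from S being only used after the empty word; since S is B0 with one point
   added, this is the basis of the tensor algebra T(M) tensored with Z + Z[1]. *)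
Fixpoint words (n p : nat) : choiceType :=
  if n is n1.+1 then
    if n1 is m.+1 then (B0 * words n1 p + shift (fun i => (B1 * words m i)%type) p)%type
    else if p is 0 then S else void
  else if p is 0 then unit else void.

Fixpoint power_words (j p : nat) : choiceType :=
  if j is i.+1 then
    (B0 * power_words i p + shift (fun k => (B1 * power_words i k)%type) p)%type
  else if p is 0 then unit else void.

(** The basis of the row with j + 1 factors. The last factor is unreduced, with basis [S] in degree
    0 and [B1] in degree 1. *)
Definition row_words (j p : nat) : choiceType :=
  (power_words j p * S + shift (fun k => (power_words j k * B1)%type) p)%type.

(** Each unit of degree costs a letter of length 2, so a word of degree p has length at least 2p. *)
Lemma words_empty n p : (0 < p)%N -> (n <= p)%N -> words n p -> False.
Proof.
elim/ltn_ind: n p => -[|[|n]] IH [|p] //= _ np [[_ w]|[_ w]].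
  by apply: (IH n.+1 _ p.+1 _ _ w) => //; lia.
by apply: (IH n _ p _ _ w); lia.
Qed.

(** A row element has j + 1 letters, p of them of length 2, hence total length j + 1 + p. A last
    letter of degree 0 comes from [S], one of degree 1 from [B1] followed by the empty word. *)
Lemma row_words_words j p : equinumerous (row_words j p) (words (j.+1 + p) p).
Proof.
elim: j p => [|j IH] p.
{ case: p => [|[|p]] /=.
  - apply: equinumerous_trans (equinumerous_inl _ _) _ => //.
    by exists snd; exists (fun s => (tt, s)) => // -[[]].
  - apply: equinumerous_trans (equinumerous_inr _ _) _; first by case.
    apply: (@equinumerous_trans _ (B1 * unit)%type); last first.
      exists inr; exists (fun s : (B0 * void + B1 * unit) =>
        match s with inr x => x | inl (_, y) => match y : void with end end) => //.
      by case=> [[_ []]|].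
    by exists (fun c => (c.2, c.1)); exists (fun c => (c.2, c.1)) => -[].
  - apply: equinumerous_empty => [[[] []|[] []]|] //.
    move=> [[_]|[_]]; first exact: (@words_empty p.+2 p.+2).
    exact: (@words_empty p.+1 p.+1). }
(* The first letter is split off. The degrees 0, 1 and at least 2 are separated because up to two
   nested [shift]s have to compute. *)
have rowS q : equinumerous (row_words j.+1 q)
     (B0 * words (j.+1 + q) q + shift (fun k => (B1 * words (j.+1 + k) k)%type) q)%type.
  have IH1 := equinumerous_prod (equinumerous_refl B1) (IH _).
  have IH0 := equinumerous_prod (equinumerous_refl B0) (IH _).
  case: q => [|q].
    apply: equinumerous_trans (equinumerous_sum (IH0 _) (equinumerous_refl _)).
    exists (fun s : row_words j.+1 0 => match s with
       | inl (inl (b, u), s) => inl (b, inl (u, s))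
       | inl (inr y, _) => match y : void with end
       | inr y => match y : void with end end).
    exists (fun s : (B0 * row_words j 0 + void) => match s with
       | inl (b, inl (u, s)) => inl (inl (b, u), s)
       | inl (_, inr y) => match y : void with end
       | inr y => match y : void with end end).
      by case=> [[[[b u]|[]] s]|[]].
    by case=> [[b [[u s]|[]]]|[]].
  apply: equinumerous_trans (equinumerous_sum (IH0 _) (IH1 _)).
  case: q => [|q].
    exists (fun s : row_words j.+1 1 => match s with
       | inl (inl (b, u), s) => inl (b, inl (u, s))
       | inl (inr (b, u), s) => inr (b, inl (u, s))
       | inr (inl (b, u), s) => inl (b, inr (u, s))
       | inr (inr y, _) => match y : void with end end).
    exists (fun s : (B0 * row_words j 1 + B1 * row_words j 0) => match s with
       | inl (b, inl (u, s)) => inl (inl (b, u), s)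
       | inl (b, inr (u, s)) => inr (inl (b, u), s)
       | inr (b, inl (u, s)) => inl (inr (b, u), s)
       | inr (_, inr y) => match y : void with end end).
      by case=> [[[[b u]|[b u]] s]|[[[b u]|[]] s]].
    by case=> [[b [[u s]|[u s]]]|[b [[u s]|[]]]].
  exists (fun s : row_words j.+1 q.+2 => match s with
     | inl (inl (b, u), s) => inl (b, inl (u, s))
     | inl (inr (b, u), s) => inr (b, inl (u, s))
     | inr (inl (b, u), s) => inl (b, inr (u, s))
     | inr (inr (b, u), s) => inr (b, inr (u, s)) end).
  exists (fun s : (B0 * row_words j q.+2 + B1 * row_words j q.+1) => match s with
     | inl (b, inl (u, s)) => inl (inl (b, u), s)
     | inl (b, inr (u, s)) => inr (inl (b, u), s)
     | inr (b, inl (u, s)) => inl (inr (b, u), s)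
     | inr (b, inr (u, s)) => inr (inr (b, u), s) end).
    by case=> [[[[b u]|[b u]] s]|[[[b u]|[b u]] s]].
  by case=> [[b [[u s]|[u s]]]|[b [[u s]|[u s]]]].
case: p => [|p]; first exact: rowS.
by have := rowS p.+1; rewrite !addSn !addnS.
Qed.

Section Page.
Variables (R : realType) (T : topologicalType).

Let hbasis (K : choiceType) n : choiceType :=
  if n is m.+1 then (if m is 0 then B1 else void) else K.

Hypothesis H0 : isomorphic (singular_homology R T 0) {freeg S}.
Hypothesis H1 : isomorphic (singular_homology R T 1) {freeg B1}.
Hypothesis H2 : forall n (x : singular_homology R T n.+2), x = 0.
Hypothesis K0 : isomorphic (reduced_homology R T 0) {freeg B0}.
Hypothesis K1 : isomorphic (reduced_homology R T 1) {freeg B1}.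
Hypothesis K2 : forall n (x : reduced_homology R T n.+2), x = 0.

Lemma E2_row_words m p : isomorphic (E2_row R T m p) {freeg (words (m + p) p)}.
Proof.
have V0 (D : {freeg void}) : D = 0 by apply: freeg_empty.
have unitE i : isomorphic (graded_unit i) {freeg (words 0 i)}.
  by case: i => [|i] /=; [apply: (int_freeg_unique (k := tt)) => -[]|apply: zmod0_freeg].
have HS i : isomorphic (singular_homology R T i) {freeg (hbasis S i)}.
  by case: i => [|[|i]] //; apply: isomorphic_trivial.
have HB i : isomorphic (reduced_homology R T i) {freeg (hbasis B0 i)}.
  by case: i => [|[|i]] //; apply: isomorphic_trivial.
have HP j i : isomorphic (graded_power (reduced_homology R T) j i) {freeg (power_words j i)}.
  elim: j i => [|j IH] i; first by case: i => [|i]; [exact: (unitE 0)|exact: (unitE i.+1)].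
  apply: isomorphic_trans (graded_tensor_freeg _ HB IH) _.
  apply: isomorphic_freeg; apply: equinumerous_trans (disjoint_union_first2 _ _) _.
    by move=> k [].
  rewrite /= subn0; apply: equinumerous_sum; first exact: equinumerous_refl.
  by case: i => [|i]; rewrite /= ?subn1; apply: equinumerous_refl.
case: m => [|m].
  case: p => [|p]; first exact: (unitE 0).
  apply: zmod0_freeg; exact: (@words_empty p.+1 p.+1).
apply: isomorphic_trans (graded_tensor_freeg _ (HP m) HS) _.
apply: isomorphic_freeg; apply: equinumerous_trans (row_words_words m p).
apply: equinumerous_trans (disjoint_union_last2 _) _ => [i ip|].
  have {ip}: (1 < p - i)%N by lia.
  by case: (p - i)%N => [|[|k]] // _ [_ []].
rewrite /= subnn; apply: equinumerous_sum; first exact: equinumerous_refl.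
by case: p => [|p]; rewrite /= ?subSnn; apply: equinumerous_refl.
Qed.
End Page.
End Words.

(** * Orbits of a permutation *)

Lemma int_eq_ind (V : zmodType) (f g : int -> V) :
  f 0 = g 0 -> (forall k, f (k + 1) - f k = g (k + 1) - g k) -> f =1 g.
Proof.
move=> fg0 fgS; elim=> [|n IH|n IH] //.
  by have := fgS n; rewrite -PoszD addn1 IH => /addIr.
have := fgS (- n.+1%:Z).
by rewrite (_ : - n.+1%:Z + 1 = - n%:Z) ?IH; [move=> /addrI/oppr_inj | lia].
Qed.

(* The sum of the values of f over [0, k[, with the convention of integral
   calculus for negative k. *)
Definition signed_sum (V : zmodType) (f : int -> V) (k : int) : V :=
  match k with
  | Posz n => \sum_(i < n) f i
  | Negz n => - \sum_(i < n.+1) f (- i.+1%:Z)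
  end.

Lemma signed_sumS (V : zmodType) (f : int -> V) k :
  signed_sum f (k + 1) = signed_sum f k + f k.
Proof.
case: k => [n|[|n]]; first by rewrite -PoszD addn1 /= big_ord_recr.
  by rewrite /= big_ord0 big_ord1 addNr.
have -> : Negz n.+1 + 1 = Negz n by lia.
by rewrite /= [in RHS]big_ord_recr /= opprD NegzE addrNK.
Qed.

Lemma signed_sum0 (V : zmodType) (f : int -> V) : signed_sum f 0 = 0.
Proof. by rewrite /= big_ord0. Qed.

Lemma signed_sum_additive (U V : zmodType) (h : U -> V) (f : int -> U) k :
  zmod_morphism h -> h (signed_sum f k) = signed_sum (h \o f) k.
Proof.
move=> /additive_of[H HE]; move: k; apply: int_eq_ind => [|k].
  by rewrite !signed_sum0 -HE raddf0.
by rewrite !signed_sumS -!HE raddfD !HE [LHS]addrAC [RHS]addrAC !subrr.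
Qed.

Lemma signed_sum_telescope (V : zmodType) (f : int -> V) k :
  signed_sum (fun i => f i - f (i + 1)) k = f 0 - f k.
Proof.
move: k; apply: int_eq_ind => [|k]; first by rewrite signed_sum0 subrr.
by rewrite signed_sumS [LHS]addrAC subrr add0r opprB [RHS]addrC addrA subrK.
Qed.

Section Orbits.
Variables (X : choiceType) (phi : X -> X) (phi_bij : bijective phi).

Notation pow := (perm_pow phi_bij).

Definition same_orbit (x y : X) : bool := `[< exists n : int, y = pow n x >].

(** An equality of predicates, so that [choose] in [orbit_rep] is applied to one and the same
    predicate along the whole orbit. *)
Lemma same_orbit_pow n x : same_orbit (pow n x) = same_orbit x.
Proof.
apply/funext => y; apply/asboolP/asboolP => -[m ->].
  by exists (m + n); rewrite perm_powD.
by exists (m - n); rewrite -perm_powD subrK.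
Qed.

Lemma same_orbit_refl x : same_orbit x x.
Proof. by apply/asboolP; exists 0. Qed.

Definition orbit_rep (x : X) : X := choose (same_orbit x) x.

Lemma orbit_repP x : exists n : int, x = pow n (orbit_rep x).
Proof.
have /asboolP[n e] := chooseP (same_orbit_refl x).
by exists (- n); rewrite /orbit_rep e -perm_powD addNr.
Qed.

Lemma orbit_rep_pow n x : orbit_rep (pow n x) = orbit_rep x.
Proof.
rewrite /orbit_rep same_orbit_pow; apply: choose_id; last exact: same_orbit_refl.
by rewrite -(same_orbit_pow n) same_orbit_refl.
Qed.

Lemma orbit_rep_phi x : orbit_rep (phi x) = orbit_rep x.
Proof. exact: (orbit_rep_pow 1). Qed.

Lemma orbit_rep_id x : orbit_rep (orbit_rep x) = orbit_rep x.
Proof. by have [n e] := orbit_repP x; rewrite [in RHS]e orbit_rep_pow. Qed.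

(** The extra [phi] makes n + 1 the period, hence positive. Asking at the representative makes the
    property visibly constant on orbits. *)
Definition finite_orbit (x : X) : bool :=
  `[< exists n : nat, phi (pow n (orbit_rep x)) = orbit_rep x >].

Lemma finite_orbit_phi x : finite_orbit (phi x) = finite_orbit x.
Proof. by rewrite /finite_orbit orbit_rep_phi. Qed.

Lemma finite_orbit_rep x : finite_orbit (orbit_rep x) = finite_orbit x.
Proof. by rewrite /finite_orbit orbit_rep_id. Qed.

(** In a finite orbit the exponent is determined only modulo the period; the least natural one is
    taken, so that exponents run from 0 to the period minus 1. *)
Lemma orbit_exponent_subproof x : exists k : int, x = pow k (orbit_rep x) /\
  (finite_orbit x -> exists2 n : nat, k = n &
    forall m : nat, x = pow m (orbit_rep x) -> (n <= m)%N).
Proof.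
have [k xk] := orbit_repP x.
case: (boolP (finite_orbit x)) => [/asboolP[N pN]|]; last by exists k.
have ex : exists n : nat, x == pow n (orbit_rep x).
  case: k xk => k xk; first by exists k; apply/eqP.
  have pNj j : pow (j * N.+1)%N (orbit_rep x) = orbit_rep x.
    elim: j => [|j IH] //; rewrite mulSn PoszD perm_powD IH.
    by rewrite -addn1 PoszD perm_powD1.
  (* The exponent -(k + 1) becomes natural when k + 1 times the period N + 1 is added. *)
  exists (k.+1 * N)%N; apply/eqP; rewrite {1}xk -{1}(pNj k.+1) -perm_powD.
  by congr (pow _ _); lia.
exists (ex_minn ex); case: ex_minnP => n /eqP xn nmin; split=> // _; exists n => // m xm.
by apply: nmin; apply/eqP.
Qed.

Definition orbit_exponent x : int := sval (cid (orbit_exponent_subproof x)).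

Lemma orbit_exponentK x : pow (orbit_exponent x) (orbit_rep x) = x.
Proof. by rewrite /orbit_exponent; case: cid => k [<-]. Qed.

Lemma orbit_exponent_finite x : finite_orbit x -> exists2 n : nat, orbit_exponent x = n &
  forall m : nat, x = pow m (orbit_rep x) -> (n <= m)%N.
Proof. by rewrite /orbit_exponent; case: cid => k []. Qed.

(** The exponent grows by one along [phi] except where a finite orbit closes up. *)
Lemma orbit_exponent_phi x : ~~ (finite_orbit x && (phi x == orbit_rep x)) ->
  orbit_exponent (phi x) = orbit_exponent x + 1.
Proof.
case: (boolP (finite_orbit x)) => [fx /= nx|nfx _].
  have [n en nmin] := orbit_exponent_finite fx.
  have := fx; rewrite -finite_orbit_phi => /orbit_exponent_finite[m em mmin].
  move: (orbit_exponentK (phi x)) (orbit_exponentK x).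
  rewrite em en orbit_rep_phi => pm pn; apply/eqP; rewrite -PoszD addn1 eqz_nat eqn_leq.
  rewrite mmin; last by rewrite orbit_rep_phi -addn1 PoszD perm_powD1 pn.
  case: m {em mmin} pm nx => [/= ->|m]; first by rewrite eqxx.
  rewrite -addn1 PoszD perm_powD1 => /(can_inj (permK phi_bij)) pm _.
  by rewrite addn1 ltnS nmin.
apply/eqP; apply: contraNT nfx => ne.
have p1 : pow (orbit_exponent x + 1) (orbit_rep x) = pow (orbit_exponent (phi x)) (orbit_rep x).
  by rewrite perm_powD1 orbit_exponentK -[in RHS]orbit_rep_phi orbit_exponentK.
have [a [b [ab pab]]] : exists a b : int, a < b /\ pow a (orbit_rep x) = pow b (orbit_rep x).
  move: ne; rewrite neq_lt => /orP[] lt.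
    by exists (orbit_exponent (phi x)), (orbit_exponent x + 1).
  by exists (orbit_exponent x + 1), (orbit_exponent (phi x)).
(* Two exponents a < b of the same point give the period b - a; the 1 is subtracted because
   [finite_orbit] adds it back through [phi]. *)
apply/asboolP; exists `|(b - a - 1)%R|%N; rewrite -perm_powD1.
rewrite (_ : Posz _ + 1 = - a + b); last by lia.
by rewrite perm_powD -pab -perm_powD addNr.
Qed.

Definition orbits : choiceType := {x : X | orbit_rep x == x}.
Definition finite_orbits : choiceType := {x : X | (orbit_rep x == x) && finite_orbit x}.

Definition orbit_of (x : X) : orbits := exist _ (orbit_rep x) (introT eqP (orbit_rep_id x)).

Definition one_sub (c : {freeg X}) : {freeg X} := free_map (fun x => << x >> - << phi x >>) c.

Lemma one_subB : zmod_morphism one_sub. Proof. exact: raddfB. Qed.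

HB.instance Definition _ :=
  GRing.isZmodMorphism.Build {freeg X} {freeg X} one_sub one_subB.

Lemma one_subU x : one_sub << x >> = << x >> - << phi x >>.
Proof. exact: free_mapU. Qed.

Lemma one_sub_sum k x :
  one_sub (signed_sum (fun i => << pow i x >>) k) = << x >> - << pow k x >>.
Proof.
rewrite (signed_sum_additive _ _ one_subB).
rewrite -(signed_sum_telescope (fun i => << pow i x >>)); congr (signed_sum _ k).
by apply/funext => i /=; rewrite one_subU perm_powD1.
Qed.

(** With X seen as a graph with an edge from x to [phi x], this is minus the path from the
    representative to x; [1 - phi] is the boundary up to sign. *)
Definition orbit_homotopy (x : X) : {freeg X} :=
  - signed_sum (fun i => << pow i (orbit_rep x) >>) (orbit_exponent x).

Lemma one_sub_homotopy x : one_sub (orbit_homotopy x) = << x >> - << orbit_rep x >>.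
Proof. by rewrite raddfN /= one_sub_sum orbit_exponentK opprB. Qed.

(** The sum over a finite orbit: the predecessor of the representative has the largest exponent, the
    period minus 1, so the upper limit is the period. *)
Definition orbit_cycle (o : finite_orbits) : {freeg X} :=
  signed_sum (fun i => << pow i (val o) >>) (orbit_exponent (perm_inv phi_bij (val o)) + 1).

(** The coefficient of one marked edge in each finite orbit, the edge returning to the
    representative; it serves to recover a cycle from its coefficients. On infinite orbits [insub]
    fails and the value is 0. *)
Definition orbit_count (x : X) : {freeg finite_orbits} :=
  if phi x == orbit_rep x then
    if insub (orbit_rep x) is Some o then << o >> else 0
  else 0.

Lemma orbit_rep_finite_orbits (o : finite_orbits) : orbit_rep (val o) = val o.
Proof. by case/andP: (valP o) => /eqP. Qed.

Lemma orbit_rep_inv x : orbit_rep (perm_inv phi_bij x) = orbit_rep x.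
Proof. by rewrite -[in RHS](perm_invK phi_bij x) orbit_rep_phi. Qed.

Lemma one_sub_cycle o : one_sub (orbit_cycle o) = 0.
Proof.
rewrite /orbit_cycle one_sub_sum perm_powD1.
by rewrite -{3}orbit_rep_finite_orbits -orbit_rep_inv orbit_exponentK perm_invK subrr.
Qed.

(** Consecutive paths differ by one edge, except at the marked edge, where the path is reset and a
    whole orbit sum is lost. *)
Lemma homotopy_one_sub x :
  orbit_homotopy x - orbit_homotopy (phi x) = << x >> - free_map orbit_cycle (orbit_count x).
Proof.
rewrite /orbit_count /orbit_homotopy orbit_rep_phi opprK.
have [/andP[fx px]|] := boolP (finite_orbit x && (phi x == orbit_rep x)); last first.
  move=> ne; rewrite (orbit_exponent_phi ne) signed_sumS orbit_exponentK addKr.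
  case: eqP ne => [_|]; last by rewrite raddf0 subr0.
  by rewrite andbT => nfx; rewrite insubN /= ?orbit_rep_id ?eqxx ?finite_orbit_rep // raddf0 subr0.
rewrite px insubT ?orbit_rep_id ?eqxx ?finite_orbit_rep // => ox.
rewrite free_mapU /orbit_cycle /= -(eqP px) permK signed_sumS (eqP px) orbit_exponentK opprD.
have -> : orbit_exponent (orbit_rep x) = 0.
  have := fx; rewrite -finite_orbit_rep => /orbit_exponent_finite[n -> nmin].
  by have := nmin 0%N; rewrite orbit_rep_id leqn0 => /(_ erefl)/eqP->.
by rewrite signed_sum0 addr0 [RHS]addrCA subrr addr0.
Qed.

Lemma orbit_count_cycle o : free_map orbit_count (orbit_cycle o) = << o >>.
Proof.
have /andP[/eqP ro fo] := valP o; rewrite /orbit_cycle.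
have : finite_orbit (perm_inv phi_bij (val o)).
  by rewrite -finite_orbit_phi perm_invK.
move=> /orbit_exponent_finite[n en]; rewrite en orbit_rep_inv ro => nmin.
have := orbit_exponentK (perm_inv phi_bij (val o)); rewrite en orbit_rep_inv ro => pn.
rewrite signed_sumS raddfD /= raddf_sum /= big1 => [|i _].
  rewrite add0r free_mapU [iter _ _ _]pn /orbit_count perm_invK orbit_rep_inv ro eqxx.
  by rewrite insubT ?ro ?eqxx // => p; congr << _ >>; apply: val_inj.
rewrite free_mapU /orbit_count (orbit_rep_pow i) ro.
(* An earlier point mapped to the representative would be the same predecessor with a smaller
   exponent, against minimality. *)
case: eqP => // e; have := nmin i; rewrite leqNgt ltn_ord => H.
by apply: contraTeq (isT) => _; apply: H; rewrite -[in LHS]e permK.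
Qed.
End Orbits.

(** * Simplices and lifting along the covering *)

Section SimplexTopology.
Variables (R : realType) (n : nat).
Local Open Scope classical_set_scope.

Notation Delta := (simplex R n).

Lemma simplex_cvg (T : Type) (F : set_system T) (f : T -> Delta) (a : Delta)
    (v : 'rV[R]_n.+1) :
  Filter F -> v = val a -> (fun x => val (f x)) @ F --> v -> f @ F --> a.
Proof.
move=> FF -> cf U [O [[W oW <-] Wa WU]].
have FW : F (fun x => W (val (f x))) by apply: cf; apply: open_nbhs_nbhs.
exact: (@filterS _ F FF _ _ (fun x Wx => WU (f x) Wx) FW).
Qed.

Lemma simplex_val_continuous : continuous (val : Delta -> 'rV[R]_n.+1).
Proof. exact: initial_continuous. Qed.

Lemma simplex_coord_continuous i : continuous (fun t : Delta => val t 0 i).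
Proof.
move=> t; apply: (@continuous_comp _ _ _ (val : Delta -> _) (fun v : 'rV[R]_n.+1 => v 0 i)).
  exact: simplex_val_continuous.
exact: coord_continuous.
Qed.

Lemma simplex_ge0 (t : Delta) i : 0 <= val t 0 i.
Proof. by case: t => t /= /set_mem[]. Qed.

Lemma simplex_sum (t : Delta) : \sum_i val t 0 i = 1.
Proof. by case: t => t /= /set_mem[]. Qed.

Lemma simplex_le1 (t : Delta) i : val t 0 i <= 1.
Proof.
rewrite -(simplex_sum t) (bigD1 i) //= lerDl; apply: sumr_ge0 => j _.
exact: simplex_ge0.
Qed.

Lemma simplex_set_compact : compact (@simplex_set R n).
Proof.
apply: (@subclosed_compact _ _ [set v : 'rV[R]_n.+1 | forall i, `[0, 1]%classic (v 0 i)]).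
- rewrite (_ : @simplex_set R n = (\bigcap_(i in [set: 'I_n.+1])
      ((fun v : 'rV[R]_n.+1 => v 0 i) @^-1` [set x | 0 <= x])) `&`
      ((fun v : 'rV[R]_n.+1 => \sum_i v 0 i) @^-1` [set 1])); last first.
    apply/seteqP; split => v /= [v0 v1]; split => // i; last exact: v0.
    by move=> _; apply: v0.
  apply: closedI.
    apply: closed_bigI => i _; apply: closed_comp; last exact: closed_ge.
    by move=> v _; apply: coord_continuous.
  apply: closed_comp; last exact: closed_eq.
  move=> v _; apply: cvg_big => [| |i _]; [exact: add_continuous|exact: nbhs_filter|].
  exact: coord_continuous.
- by apply: (@rV_compact R n.+1 (fun=> `[0, 1]%classic)) => i; exact: segment_compact.
- move=> v vs i; have := mem_set vs => vs'.
  rewrite /= in_itv /= (simplex_ge0 (exist _ v vs') i).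
  exact: (simplex_le1 (exist _ v vs') i).
Qed.

Lemma simplex_compact : compact [set: Delta].
Proof.
move=> F PF _.
have [|x [xs clx]] := simplex_set_compact (fmap_proper_filter (val : Delta -> _) PF).
  by apply: (@filterE _ F) => -[t ts]; apply: set_mem ts.
exists (exist _ x (mem_set xs)); split => // A B FA [O [[W oW <-] Wx WB]].
have [||y [[a Aa <-] Wa]] := clx [set val (t : Delta) | t in A] W; last by exists a; split => //; apply: WB.
  by apply: (@filterS _ F _ _ _ _ FA) => a Aa; exists a.
exact: open_nbhs_nbhs.
Qed.

(** The retraction of the line onto [0, 1]; it makes [segment] defined and continuous for every real
    parameter. *)
Definition clamp (s : R) : R := 2^-1 * (`|s| - `|s - 1| + 1).

Lemma clamp_continuous : continuous clamp.
Proof.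
move=> s; apply: cvgMl_tmp; apply: cvgD; last exact: cvg_cst.
apply: cvgB; apply: cvg_norm; first exact: cvg_id.
by apply: cvgB; [exact: cvg_id|exact: cvg_cst].
Qed.

Lemma clamp_itv s : 0 <= clamp s <= 1.
Proof.
rewrite /clamp; case: (ler0P s) => s0; case: (ler0P (s - 1)) => s1; lra.
Qed.

Lemma clamp_id s : 0 <= s <= 1 -> clamp s = s.
Proof.
case/andP => s0 s1; rewrite /clamp ger0_norm // ler0_norm ?subr_le0 //; lra.
Qed.

Lemma segment_subproof (s : R) (p q : Delta) :
  (1 - clamp s) *: val p + clamp s *: val q \in @simplex_set R n.
Proof.
have /andP[s0 s1] := clamp_itv s.
apply/mem_set; split => [i|].
  by rewrite !mxE addr_ge0 // mulr_ge0 ?simplex_ge0 // subr_ge0.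
under eq_bigr do rewrite !mxE.
by rewrite big_split /= -!mulr_sumr !simplex_sum !mulr1 subrK.
Qed.

Definition segment (p : Delta) (c : R * Delta) : Delta :=
  exist _ ((1 - clamp c.1) *: val p + clamp c.1 *: val c.2) (segment_subproof c.1 p c.2).

Lemma segment_continuous p : continuous (segment p).
Proof.
move=> c; apply: simplex_cvg => [//|/=].
have c1 : clamp x.1 @[x --> c] --> clamp c.1.
  by apply: (cvg_comp _ _ (cvg_fst)); exact: clamp_continuous.
apply: cvgD; apply: cvgZ.
- by apply: cvgB => //; apply: cvg_cst.
- exact: cvg_cst.
- by [].
- apply: (cvg_comp _ _ (cvg_snd)); exact: simplex_val_continuous.
Qed.

Lemma segment0 p q : segment p (0, q) = p.
Proof.
by apply: val_inj; rewrite /= clamp_id ?lexx ?ler01 // scale0r subr0 scale1r addr0.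
Qed.

Lemma segment1 p q : segment p (1, q) = q.
Proof.
by apply: val_inj; rewrite /= clamp_id ?lexx ?ler01 // subrr scale0r scale1r add0r.
Qed.

(** Restriction to the segment from p to q reduces this to the connectedness of [0, 1]; the set of
    parameters with the initial value is open and closed. *)
Lemma locally_constant (U : Type) (f : Delta -> U) :
  (forall p, \forall q \near p, f q = f p) -> forall p q, f p = f q.
Proof.
move=> fl p q; pose g (s : R) := f (segment p (s, q)).
have gl s : \forall s' \near s, g s' = g s.
  have sc : segment p (s', q) @[s' --> s] --> segment p (s, q).
    apply: (@cvg_comp _ _ _ (fun s' : R => (s', q)) (segment p) _ (nbhs (s, q))).
      by apply: (@cvg_pair _ _ _ (nbhs s) (nbhs s) (nbhs q)); [exact: cvg_id|exact: cvg_cst].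
    exact: (@segment_continuous p (s, q)).
  exact: (sc _ (fl (segment p (s, q)))).
have gO (P : U -> Prop) : open [set s | P (g s)].
  rewrite openE => s Ps; apply: filterS (gl s) => s' /= e.
  by rewrite /= e.
suff e : [set s | `[0, 1]%classic s /\ g s = g 0] = `[0, 1]%classic.
  have : [set s | `[0, 1]%classic s /\ g s = g 0] 1 by rewrite e /= in_itv /= lexx ler01.
  by case=> _; rewrite /g segment1 segment0.
apply: (@segment_connected R 0 1).
- by exists 0; split => //; rewrite /= in_itv /= lexx ler01.
- by exists [set s | g s = g 0] => //; apply: (gO (fun u => u = g 0)).
- exists [set s | g s = g 0] => //.
  rewrite -[X in closed X]setCK closedC.
  exact: (gO (fun u => u <> g 0)).
Qed.
End SimplexTopology.

(** * The covering of the homotopy orbit space and its flow *)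

Section Covering.
Variables (R : realType) (X : choiceType) (phi : X -> X) (phi_bij : bijective phi).
Local Open Scope classical_set_scope.

Notation pow := (perm_pow phi_bij).
Notation Xt := (EZ_times R X).
Notation Y := (homotopy_orbits R phi_bij).

Definition covering_map (a : Xt) : Y := \pi_({eq_quot (orbit_rel phi_bij)}) a.

Lemma covering_map_continuous : continuous covering_map.
Proof. exact: pi_continuous. Qed.

HB.instance Definition _ := isContinuous.Build Xt Y covering_map covering_map_continuous.

Definition deck (n : int) (a : Xt) : Xt := (a.1 + n%:~R, pow n a.2).

Lemma deck_continuous n : continuous (deck n).
Proof.
move=> a; apply: (@cvg_pair _ _ _ (nbhs a) (nbhs (a.1 + n%:~R)) (nbhs (pow n a.2 : discrete_topology X))).
  by apply: cvgD; [exact: cvg_fst|exact: cvg_cst].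
apply: (@cvg_comp _ _ _ snd (pow n) (nbhs a) (nbhs a.2)); first exact: cvg_snd.
move=> U /nbhs_singleton Un; apply: (filterS _ (discrete_set1 a.2)) => x ->.
exact: Un.
Qed.

HB.instance Definition _ n := isContinuous.Build Xt Xt (deck n) (@deck_continuous n).

Lemma covering_mapP (a b : Xt) :
  covering_map a = covering_map b <-> exists n, b = deck n a.
Proof.
have -> : covering_map a = covering_map b <-> orbit_rel phi_bij a b.
  by split => [|ab]; [move/eqquotP|apply/eqquotP].
split=> [/asboolP[n [b1 b2]]|[n ->]]; last by apply/asboolP; exists n.
by exists n; rewrite /deck -b1 -b2; case: (b).
Qed.

Lemma covering_map_surj y : exists a, covering_map a = y.
Proof. by exists (repr y); exact: reprK. Qed.

Definition translate (d : R) (a : Xt) : Xt := (a.1 + d, a.2).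

(** Translations commute with deck transformations and so descend to a flow on Y. As a relation the
    flow needs no map defined on the quotient. *)
Definition translated (d : R) (y y' : Y) : Prop :=
  exists2 a, y = covering_map a & y' = covering_map (translate d a).

Lemma translatedE d a y' :
  translated d (covering_map a) y' -> y' = covering_map (translate d a).
Proof.
move=> [b /covering_mapP[n ->] ->]; apply/esym/covering_mapP; exists n.
by rewrite /deck /translate /= addrAC.
Qed.

(** Times carrying y to the same point differ by an integer, and an integer of absolute value below
    1 is 0. *)
Lemma translated_inj d d' y y' : translated d y y' -> translated d' y y' ->
  `|d - d'| < 1 -> d = d'.
Proof.
have [a <-] := covering_map_surj y.
move=> /translatedE -> /translatedE/covering_mapP[n [e _]].
have -> : d - d' = (- n)%:~R by rewrite rmorphN /=; lra.
rewrite -intr_norm -[1]/(1%:~R) ltr_int => n0.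
have n00 : n = 0 by lia.
by move: e; rewrite n00; lra.
Qed.

(** The substitute for an evenly covered neighbourhood: as X is discrete, all points near a are
    small translates of a. *)
Lemma translated_nbhs (y : Y) (e : R) : 0 < e ->
  \forall y' \near y, exists2 d, `|d| < e & translated d y y'.
Proof.
move=> e0; apply: open_nbhs_nbhs; split; last first.
  exists 0; first by rewrite normr0.
  have [a <-] := covering_map_surj y; exists a => //.
  by rewrite /translate addr0; case: (a).
have [a <-] := covering_map_surj y.
rewrite /open /= /quotient_open openE => b [d de /translatedE].
rewrite -[\pi_ _ _]/(covering_map b) => /esym/covering_mapP[n bE].
exists (ball b.1 (e - `|d|), [set b.2]) => /=.
  by split; [apply: nbhsx_ballx; lra|exact: discrete_set1].
move=> c [/= c1 c2]; exists (d + (c.1 - b.1)).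
  apply: le_lt_trans (ler_normD _ _) _.
  by move: c1; rewrite /ball /= distrC; lra.
exists a => //; apply/esym/covering_mapP; exists n.
rewrite {}bE in c1 c2 *; case: c c2 {c1} => c1 c2 /= ->.
by rewrite /deck /translate /=; congr (_, _); lra.
Qed.

Lemma translation_continuous (T : topologicalType) (f g : T -> Y) (d : T -> R) :
  continuous f -> continuous g ->
  (forall p, `|d p| < 1 / 2 /\ translated (d p) (f p) (g p)) -> continuous d.
Proof.
move=> fc gc dP p; apply/cvgrPdist_lt => e e0.
have [d0 dt] := dP p.
(* Room for two errors [u] and [v]: the first bound keeps their difference below e, the second keeps
   [d p + v - u] below 1/2, hence less than 1 away from [d q], so that uniqueness applies. *)
pose e' := Num.min (e / 2) ((1 / 2 - `|d p|) / 2).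
have e'0 : 0 < e' by rewrite lt_min; apply/andP; split; lra.
have [e'1 e'2] : e' <= e / 2 /\ e' <= (1 / 2 - `|d p|) / 2.
  by split; rewrite /e' ge_min lexx ?orbT.
have fn := fc p _ (translated_nbhs (f p) e'0).
have gn := gc p _ (translated_nbhs (g p) e'0).
near=> q.
have [u ue fq] : exists2 d, `|d| < e' & translated d (f p) (f q) by near: q.
have [v ve gq] : exists2 d, `|d| < e' & translated d (g p) (g q) by near: q.
have [a fpE] := covering_map_surj (f p).
have gpE : g p = covering_map (translate (d p) a) by apply: translatedE; rewrite fpE.
have fqE : f q = covering_map (translate u a) by apply: translatedE; rewrite fpE.
have gqE : g q = covering_map (translate v (translate (d p) a)).
  by apply: translatedE; rewrite -gpE.
have dq : translated (d p + v - u) (f q) (g q).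
  exists (translate u a) => //; rewrite gqE; congr (covering_map (_, _)) => /=; lra.
have [dq1 dqt] := dP q.
have de : d q = d p + v - u.
  apply: translated_inj dqt dq _.
  have := ler_normB (d q) (d p + v - u); have := ler_normB (d p + v) u.
  have := ler_normD (d p) v; lra.
rewrite de; have := ler_normB u v.
by rewrite (_ : d p - _ = u - v); lra.
Unshelve. all: by end_near. Qed.
End Covering.

Section Lifting.
Variables (R : realType) (X : choiceType) (phi : X -> X) (phi_bij : bijective phi).
Variable n : nat.
Local Open Scope classical_set_scope.

Notation pow := (perm_pow phi_bij).
Notation Xt := (EZ_times R X).
Notation Y := (homotopy_orbits R phi_bij).
Notation proj := (@covering_map R X phi phi_bij).
Notation Delta := (simplex R n).

Lemma vertex_subproof (i : 'I_n.+1) : delta_mx 0 i \in @simplex_set R n.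
Proof.
apply/mem_set; split => [j|]; first by rewrite mxE ler0n.
rewrite (bigD1 i) //= mxE !eqxx big1 ?addr0 // => j /negbTE ji.
by rewrite mxE eqxx ji.
Qed.

Definition vertex (i : 'I_n.+1) : Delta := exist _ (delta_mx 0 i) (vertex_subproof i).

(** Compactness of the product of [0, 1] with the simplex makes one subdivision fine enough for all
    segments from v at once. *)
Lemma segment_small_steps (sigma : sing R Y n) (v : Delta) :
  exists N : nat, forall (p : Delta) (s s' : R), 0 <= s <= 1 ->
    `|s' - s| <= N.+1%:R^-1 ->
    exists2 d, `|d| < 1 / 2 & translated d (sigma (segment v (s, p))) (sigma (segment v (s', p))).
Proof.
have sc : continuous (fun c => sigma (segment v c)).
  move=> c; apply: (@continuous_comp _ _ _ (segment v) sigma).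
    exact: segment_continuous.
  exact: cts_fun.
pose P (N : nat) (c : R * Delta) := forall s', `|s' - c.1| <= N.+1%:R^-1 ->
  exists2 d, `|d| < 1 / 2 & translated d (sigma (segment v c)) (sigma (segment v (s', c.2))).
have K : compact (`[0, 1]%classic `*` [set: Delta] : set (R * Delta)%type).
  by apply: compact_setX; [exact: segment_compact|exact: simplex_compact].
have [|N _ NP] := (compact_near_coveringP _).1 K _ \oo P _; last first.
  by exists N => p s s' s01; apply: (NP N _ (s, p)) => //=; split.
move=> c0 _.
(* Two points within flow time 1/4 of a common centre are within 1/2 of each other. *)
have e0 : (0 : R) < 1 / 4 by lra.
have [[Q V] /= [/nbhs_ballP[rho /= rho0 Qrho] Vc] QV] := sc c0 _ (translated_nbhs (sigma (segment v c0)) e0).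
have rho2 : 0 < rho / 2 by lra.
exists (ball c0.1 (rho / 2) `*` V, [set N : nat | N.+1%:R^-1 < rho / 2]) => /=.
  split; last exact: (near_infty_natSinv_lt (PosNum rho2)).
  by exists (ball c0.1 (rho / 2), V) => //; split => //; apply: nbhsx_ballx.
move=> [c N] /= [[cb cV] Nr] s' s'c.
have [|u ue cu] := QV c.
  by split => //; apply: Qrho; move: cb; rewrite /ball /=; lra.
have [|w we cw] := QV (s', c.2).
  split => //; apply: Qrho; move: cb; rewrite /ball /=.
  have := ler_distD c.1 c0.1 s'; rewrite [`|c.1 - s'|]distrC => h1 h2.
  apply: le_lt_trans h1 _; rewrite [rho]splitr; apply: ltr_leD => //.
  by apply: le_trans s'c _; apply: ltW.
have [a ca] := covering_map_surj (sigma (segment v c0)).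
rewrite -ca in cu cw; rewrite (translatedE cu) (translatedE cw).
exists (w - u); first by have := ler_normB w u; lra.
by exists (translate u a) => //; congr (proj (_, _)) => /=; lra.
Qed.

(* The lift at p adds up the translations, each by less than 1/2 and hence unique,
   between consecutive points of a fine subdivision of the segment from v to p. *)
Lemma simplex_lift (sigma : sing R Y n) :
  exists tau : sing R Xt n, forall p, proj (tau p) = sigma p.
Proof.
pose v := vertex ord0.
have [N steps] := segment_small_steps sigma v.
pose t (k : nat) : R := k%:R / N.+1%:R.
have N0 : (0 : R) < N.+1%:R by rewrite ltr0n.
have /choice[d dP] : forall kp : 'I_N.+1 * Delta, exists d : R,
   `|d| < 1 / 2 /\ translated d (sigma (segment v (t kp.1, kp.2)))
                                (sigma (segment v (t kp.1.+1, kp.2))).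
  move=> [k p] /=.
  have [||e e2 te] := steps p (t k) (t k.+1); last by exists e.
    rewrite /t divr_ge0 ?ler0n // ler_pdivrMr // mul1r ler_nat; exact: ltnW.
  by rewrite /t -mulrBl -natrB // subSnn mul1r ger0_norm // invr_ge0 ler0n.
have [a aE] := covering_map_surj (sigma v).
pose r p := a.1 + \sum_(k < N.+1) d (k, p).
have dc k : continuous (fun p => d (k, p)).
  have c j : continuous (fun p => sigma (segment v (t j, p))).
    move=> p; apply: (@continuous_comp _ _ _ (fun q => segment v (t j, q)) sigma); last exact: cts_fun.
    apply: (@cvg_comp _ _ _ (fun q : Delta => (t j, q)) (segment v) _ (nbhs (t j, p))).
      by apply: (@cvg_pair _ _ _ (nbhs p) (nbhs (t j)) (nbhs p)); [exact: cvg_cst|exact: cvg_id].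
    exact: (@segment_continuous _ _ v (t j, p)).
  by apply: (translation_continuous (c k) (c k.+1)) => p; apply: (dP (k, p)).
have tauc : continuous (fun p => (r p, a.2) : Xt).
  move=> p; apply: (@cvg_pair _ _ _ (nbhs p) (nbhs (r p)) (nbhs (a.2 : discrete_topology X))).
    apply: cvgD; first exact: cvg_cst.
    by apply: cvg_big => [|i _]; [exact: add_continuous|exact: dc].
  exact: cvg_cst.
exists (mkcts tauc : sing R Xt n) => p.
suff H m : (m <= N.+1)%N ->
    proj (a.1 + \sum_(k < N.+1 | (k < m)%N) d (k, p), a.2) = sigma (segment v (t m, p)).
  have := H N.+1 (leqnn _); rewrite /t divff ?gt_eqF // segment1 => <-.
  by congr (proj (_ + _, _)); apply: eq_bigl => k; rewrite ltn_ord.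
elim: m => [|m IH] mN.
  by rewrite big_pred0 // addr0 /t mul0r segment0 -aE; case: (a).
have [_] := dP (Ordinal mN, p); rewrite /= -(IH (ltnW mN)) => /translatedE ->.
congr (proj (_, _)); rewrite /= -addrA; congr (_ + _).
rewrite (bigD1 (Ordinal mN)) //= addrC; congr (_ + _).
apply: eq_bigl => k; rewrite ltnS [(k < m)%N]ltn_neqAle andbC; congr (_ && _).
Qed.

Lemma sing_fst_continuous (sigma : sing R Xt n) : continuous (fun p => (sigma p).1).
Proof.
move=> p; apply: (@continuous_comp _ _ _ sigma (fst : Xt -> R)); first exact: cts_fun.
exact: cvg_fst.
Qed.

Lemma sing_snd_continuous (sigma : sing R Xt n) :
  continuous (fun p => (sigma p).2 : discrete_topology X).
Proof.
move=> p; apply: (@continuous_comp _ _ _ sigma (snd : Xt -> discrete_topology X)).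
  exact: cts_fun.
exact: cvg_snd.
Qed.

(** The difference of the real coordinates is continuous with integral values, hence constant on the
    simplex. *)
Lemma simplex_lift_unique (sigma tau : sing R Xt n) :
  (forall p, proj (sigma p) = proj (tau p)) -> exists k, tau =1 deck phi_bij k \o sigma.
Proof.
move=> e; have ex p : exists k, tau p = deck phi_bij k (sigma p) by apply/covering_mapP.
have [k kP] := choice ex.
pose g p := (tau p).1 - (sigma p).1.
have gE p : g p = (k p)%:~R by rewrite /g kP /= addrAC subrr add0r.
have gc : continuous g.
  by move=> p; exact: (cvgB (@sing_fst_continuous tau p) (@sing_fst_continuous sigma p)).
have kc : forall p q, k p = k q.
  apply: locally_constant => p; have /cvgrPdist_lt/(_ 1 ltr01) := gc p.
  apply: filterS => q; rewrite !gE -rmorphB /= -intr_norm -[1]/(1%:~R) ltr_int; lia.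
by exists (k (vertex ord0)) => p; rewrite /= kP (kc p (vertex ord0)).
Qed.

Lemma sing_snd_constant (sigma : sing R Xt n) p q : (sigma p).2 = (sigma q).2.
Proof.
apply: (locally_constant (f := fun p => (sigma p).2)) => {}p.
exact: (@sing_snd_continuous sigma p _ (discrete_set1 _)).
Qed.
End Lifting.

(** * Cones, contracting the components of the covering space *)

Section Cone.
Variables (R : realType) (n : nat).
Local Open Scope classical_set_scope.

Definition simplex_tail (t : simplex R n.+1) : 'rV[R]_n.+1 :=
  (1 - val t 0 ord0)^-1 *: \row_j val t 0 (lift ord0 j).

(* An arbitrary point at the apex of the cone, where the division is by 0. *)
Definition tail_point (t : simplex R n.+1) : simplex R n :=
  insubd (vertex R ord0) (simplex_tail t).

Lemma simplex_tail_sum (t : simplex R n.+1) :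
  \sum_j val t 0 (lift ord0 j) = 1 - val t 0 ord0.
Proof. by rewrite -[in RHS](simplex_sum t) [in RHS]big_ord_recl addrAC subrr add0r. Qed.

Lemma tail_pointE (t : simplex R n.+1) : val t 0 ord0 != 1 ->
  val (tail_point t) = simplex_tail t.
Proof.
move=> t1; have t2 : 0 < 1 - val t 0 ord0.
  by rewrite subr_gt0 lt_neqAle t1 simplex_le1.
rewrite /tail_point val_insubd; case: ifP => // /negP[]; apply/mem_set.
split=> [i|]; first by rewrite !mxE mulr_ge0 ?simplex_ge0 // invr_ge0 ltW.
under eq_bigr do rewrite !mxE.
by rewrite -mulr_sumr simplex_tail_sum mulVf // gt_eqF.
Qed.

(** The linear contraction of f to 0 towards the apex, vertex 0, so that face 0 of the cone is f
    again. *)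
Definition cone_fun (f : simplex R n -> R) (t : simplex R n.+1) : R :=
  (1 - val t 0 ord0) * f (tail_point t).

Lemma cone_fun_apex f (t : simplex R n.+1) : val t 0 ord0 = 1 -> cone_fun f t = 0.
Proof. by rewrite /cone_fun => ->; rewrite subrr mul0r. Qed.

Lemma tail_point_cvg (t : simplex R n.+1) : val t 0 ord0 != 1 ->
  tail_point @ t --> tail_point t.
Proof.
move=> t1; apply: (simplex_cvg (v := simplex_tail t)); first exact: nbhs_filter.
  by rewrite tail_pointE.
have e : \forall s \near t, simplex_tail s = val (tail_point s).
  have := @simplex_coord_continuous R n.+1 ord0 t.
  move=> /cvgrPdist_lt/(_ `|val t 0 ord0 - 1|).
  rewrite normr_gt0 subr_eq0 => /(_ t1); apply: filterS => s ts.
  by rewrite tail_pointE //; apply: contraTneq ts => ->; rewrite ltxx.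
apply: cvg_trans (near_eq_cvg e) _.
apply: cvgZ.
  apply: cvgV; first by rewrite subr_eq0 eq_sym.
  by apply: cvgB; [exact: cvg_cst|exact: simplex_coord_continuous].
rewrite [X in _ --> X]row_sum_delta.
have -> : (fun s : simplex R n.+1 => \row_j val s 0 (lift ord0 j)) =
    (fun s => \sum_j val s 0 (lift ord0 j) *: delta_mx 0 j :> 'rV[R]_n.+1).
  by apply/funext => s; rewrite [LHS]row_sum_delta; apply: eq_bigr => j _; rewrite mxE.
apply: cvg_big => [|j _]; first exact: add_continuous.
by rewrite mxE; apply: cvgZr_tmp; exact: simplex_coord_continuous.
Qed.

Lemma cone_fun_continuous f : continuous f -> continuous (cone_fun f).
Proof.
move=> fc t; have [t1|t1] := eqVneq (val t 0 ord0) 1; last first.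
  have ft : f (tail_point s) @[s --> t] --> f (tail_point t).
    by apply: (@cvg_comp _ _ _ tail_point f _ (nbhs (tail_point t))); [exact: tail_point_cvg|exact: fc].
  exact: (cvgM (cvgB (cvg_cst (1 : R)) (@simplex_coord_continuous R n.+1 ord0 t)) ft).
(* At the apex [tail_point] need not converge; boundedness of f on the compact simplex suffices,
   since the other factor tends to 0. *)
have [M M0 fM] : exists2 M, 0 < M & forall p, `|f p| <= M.
  have : compact (range f).
    by apply: continuous_compact; [exact: continuous_subspaceT|exact: simplex_compact].
  move=> /compact_bounded/pinfty_ex_gt0[M M0 fM].
  by exists M => // p; apply: fM; exists p.
apply/(@cvgrPdist_lt _ _ _ _ (nbhs_filter t)) => e e0.
have := @simplex_coord_continuous R n.+1 ord0 t.
move=> /cvgrPdist_lt/(_ (e / M) (divr_gt0 e0 M0)); apply: filterS => s.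
rewrite t1 (cone_fun_apex f t1) sub0r normrN /cone_fun normrM ltr_pdivlMr //.
by apply: le_lt_trans; rewrite ler_wpM2l.
Qed.

Lemma simplex_map_lift (j : 'I_n.+2) (t : simplex R n) i :
  val (simplex_map (lift j) t) 0 (lift j i) = val t 0 i.
Proof.
rewrite mxE (bigD1 i) //= big1 ?addr0 // => k /andP[/eqP/lift_inj->].
by rewrite eqxx.
Qed.

Lemma simplex_map_lift0 (j : 'I_n.+2) (t : simplex R n) :
  val (simplex_map (lift j) t) 0 j = 0.
Proof. by rewrite mxE big1 // => k; rewrite eq_sym (negbTE (neq_lift _ _)). Qed.

Lemma tail_point_face0 (t : simplex R n) : tail_point (simplex_map (lift ord0) t) = t.
Proof.
have t0 := simplex_map_lift0 ord0 t.
apply: val_inj; rewrite tail_pointE; last by rewrite t0 eq_sym oner_neq0.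
apply/rowP => i; rewrite mxE t0 subr0 invr1 mul1r mxE.
exact: simplex_map_lift.
Qed.
End Cone.

Section ConeFaces.
Variables (R : realType) (n : nat).

Lemma simplex_map_lift_head (j : 'I_n.+2) (t : simplex R n.+1) :
  val (simplex_map (lift (lift ord0 j)) t) 0 ord0 = val t 0 ord0.
Proof.
have e : lift (lift ord0 j) ord0 = ord0 :> 'I_n.+3 by apply: val_inj.
by have := simplex_map_lift (lift ord0 j) t ord0; rewrite e.
Qed.

Lemma tail_point_faceS (j : 'I_n.+2) (t : simplex R n.+1) : val t 0 ord0 != 1 ->
  tail_point (simplex_map (lift (lift ord0 j)) t) = simplex_map (lift j) (tail_point t).
Proof.
move=> t1; apply: val_inj; rewrite tail_pointE ?simplex_map_lift_head //.
apply/rowP => k; rewrite mxE simplex_map_lift_head !mxE.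
under [RHS]eq_bigr do rewrite tail_pointE // !mxE.
rewrite -mulr_sumr; congr (_ * _); rewrite big_mkcond big_ord_recl /=.
rewrite add0r.
rewrite -big_mkcond; apply: eq_bigl => i.
have -> : lift (lift ord0 j) (lift ord0 i) = lift ord0 (lift j i).
  by apply: val_inj; rewrite /= /bump /= !add1n ltnS addnS.
by rewrite (inj_eq lift_inj).
Qed.
End ConeFaces.

Section SingularCone.
Variables (R : realType) (X : choiceType).
Local Open Scope classical_set_scope.
Notation Xt := (EZ_times R X).

Lemma cone_subproof n (sigma : sing R Xt n) : continuous (fun t =>
  (cone_fun (fun p => (sigma p).1) t, (sigma (vertex R ord0)).2) : Xt).
Proof.
move=> t; apply: (@cvg_pair _ _ _ (nbhs t) (nbhs (cone_fun (fun p => (sigma p).1) t))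
   (nbhs ((sigma (vertex R ord0)).2 : discrete_topology X))).
  exact: (cone_fun_continuous (@sing_fst_continuous R X n sigma)).
exact: cvg_cst.
Qed.

Definition sing_cone n (sigma : sing R Xt n) : sing R Xt n.+1 := mkcts (@cone_subproof n sigma).

Definition section_point (x : X) : sing R Xt 0 := cst ((0, x) : Xt).

Lemma face0_cone n (sigma : sing R Xt n) : face ord0 (sing_cone sigma) = sigma.
Proof.
apply/continuousEP => t /=; rewrite /mkcts /cone_fun simplex_map_lift0 subr0 mul1r.
rewrite tail_point_face0 (sing_snd_constant sigma _ t).
by case: (sigma t).
Qed.

Lemma faceS_cone n (j : 'I_n.+2) (sigma : sing R Xt n.+1) :
  face (lift ord0 j) (sing_cone sigma) = sing_cone (face j sigma).
Proof.
apply/continuousEP => t /=; rewrite /mkcts /=; congr (_, _); last exact: sing_snd_constant.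
have [t1|t1] := eqVneq (val t 0 ord0) 1.
  by rewrite !cone_fun_apex ?simplex_map_lift_head.
by rewrite /cone_fun simplex_map_lift_head tail_point_faceS.
Qed.

Lemma face1_cone (sigma : sing R Xt 0) :
  face (lift ord0 ord0) (sing_cone sigma) = section_point (sigma (vertex R ord0)).2.
Proof.
apply/continuousEP => t /=; rewrite /mkcts /cst; congr (_, _).
rewrite cone_fun_apex //.
have -> : ord0 = lift (lift ord0 ord0) ord0 :> 'I_2 by apply: val_inj.
by rewrite simplex_map_lift -[RHS](simplex_sum t) big_ord1.
Qed.
End SingularCone.

(** * Homology of the homotopy orbit space *)

Lemma sing_bdE (R : realType) (T : topologicalType) n (s : sing R T n.+1) :
  @sing_bd R T n << s >> = << face ord0 s >>
    - \sum_(j < n.+1) (-1) ^+ j *: << face (lift ord0 j) s >>.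
Proof.
rewrite sing_bdU big_ord_recl /= expr0 scale1r; congr (_ + _).
rewrite -sumrN; apply: eq_bigr => j _.
by rewrite /bump /= add1n exprS mulN1r scaleNr.
Qed.

Lemma zmod_morphism_sub (U V : zmodType) (f g : U -> V) :
  zmod_morphism f -> zmod_morphism g -> zmod_morphism (fun x => f x - g x).
Proof. by move=> fB gB x y; rewrite fB gB !opprD !opprK addrACA. Qed.

Section CoveringHomology.
Variables (R : realType) (X : choiceType) (phi : X -> X) (phi_bij : bijective phi).

Notation pow := (perm_pow phi_bij).
Notation Xt := (EZ_times R X).
Notation Y := (homotopy_orbits R phi_bij).
Notation Ct n := {freeg (sing R Xt n)}.
Notation C n := {freeg (sing R Y n)}.
Notation dt := (@sing_bd R Xt).
Notation dY := (@sing_bd R Y).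

Definition cone_map n (c : Ct n) : Ct n.+1 := free_map (fun s => << sing_cone s >>) c.

Lemma cone_mapB n : zmod_morphism (@cone_map n). Proof. exact: raddfB. Qed.

HB.instance Definition _ n :=
  GRing.isZmodMorphism.Build (Ct n) (Ct n.+1) (@cone_map n) (@cone_mapB n).

Lemma cone_mapU n (s : sing R Xt n) : cone_map << s >> = << sing_cone s >>.
Proof. exact: free_mapU. Qed.

(** Face 0 of a cone is the simplex itself and the other faces are the cones on its faces, so coning
    is a contracting homotopy in positive degrees. *)
Lemma cone_map_bd n (c : Ct n.+1) : dt n.+1 (cone_map c) = c - cone_map (dt n c).
Proof.
move: c; apply: freeg_ext => [x y||s]; first by rewrite !raddfB.
  by apply: zmod_morphism_sub => // x y; rewrite !raddfB.
rewrite cone_mapU sing_bdE face0_cone sing_bdU (raddf_sum (@cone_map n)); congr (_ - _).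
by apply: eq_bigr => j _; rewrite faceS_cone additiveZ /= cone_mapU.
Qed.

(** The augmentation onto ZX, the zeroth homology of the covering space, which has one contractible
    component for each point of X. *)
Definition component (c : Ct 0) : {freeg X} :=
  free_map (fun s : sing R Xt 0 => << ((s (vertex R ord0)).2 : X) >>) c.

Lemma componentB : zmod_morphism component. Proof. exact: raddfB. Qed.

HB.instance Definition _ :=
  GRing.isZmodMorphism.Build (Ct 0) {freeg X} component componentB.

Lemma componentU s : component << s >> = << ((s (vertex R ord0)).2 : X) >>.
Proof. exact: free_mapU. Qed.

Definition base_points (a : {freeg X}) : Ct 0 := free_map (fun x => << section_point R x >>) a.

Lemma base_pointsB : zmod_morphism base_points. Proof. exact: raddfB. Qed.

HB.instance Definition _ :=
  GRing.isZmodMorphism.Build {freeg X} (Ct 0) base_points base_pointsB.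

Lemma base_pointsU x : base_points << x >> = << section_point R x >>.
Proof. exact: free_mapU. Qed.

Lemma base_pointsK : cancel base_points component.
Proof.
apply: freeg_ext => [x y|//|x]; first by rewrite !raddfB.
by rewrite base_pointsU componentU.
Qed.

Lemma cone_map_bd0 (c : Ct 0) : dt 0 (cone_map c) = c - base_points (component c).
Proof.
move: c; apply: freeg_ext => [x y||s]; first by rewrite !raddfB.
  by apply: zmod_morphism_sub => // x y; rewrite !raddfB.
rewrite cone_mapU sing_bdE face0_cone big_ord1 expr0 scale1r face1_cone.
by rewrite componentU base_pointsU.
Qed.

Lemma component_bd (c : Ct 1) : component (dt 0 c) = 0.
Proof.
move: c; apply: freeg_ext => [x y|x y|s]; first by rewrite !raddfB.
  by rewrite subr0.
rewrite sing_bdE big_ord1 expr0 scale1r raddfB /= !componentU /=.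
apply/eqP; rewrite subr_eq0; apply/eqP; congr << _ >>; exact: sing_snd_constant.
Qed.

Lemma acyclicS n (c : Ct n.+1) : dt n c = 0 -> exists e, c = dt n.+1 e.
Proof. by move=> c0; exists (cone_map c); rewrite cone_map_bd c0 raddf0 subr0. Qed.

Lemma acyclic0 (c : Ct 0) : component c = 0 -> exists e, c = dt 0 e.
Proof. by move=> c0; exists (cone_map c); rewrite cone_map_bd0 c0 raddf0 subr0. Qed.

Definition push n : {additive Ct n -> C n} := @sing_map R Xt Y (covering_map phi_bij) n.

Lemma push_bd n c : dY n (push n.+1 c) = push n (dt n c).
Proof. exact: sing_map_bd. Qed.

Definition sub_deck n (c : Ct n) : Ct n := c - @sing_map R Xt Xt (deck phi_bij 1) n c.

Lemma sub_deckB n : zmod_morphism (@sub_deck n).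
Proof. by apply: zmod_morphism_sub => // x y; rewrite raddfB. Qed.

HB.instance Definition _ n :=
  GRing.isZmodMorphism.Build (Ct n) (Ct n) (@sub_deck n) (@sub_deckB n).

Lemma sub_deck_bd n c : dt n (sub_deck c) = sub_deck (dt n c).
Proof. by rewrite /sub_deck raddfB /= (@sing_map_bd R _ _ (deck phi_bij 1)). Qed.

Lemma component_sub_deck c : component (sub_deck c) = one_sub phi (component c).
Proof.
move: c; apply: freeg_ext => [x y|x y|s]; first by rewrite sub_deckB componentB.
  by rewrite componentB one_subB.
by rewrite /sub_deck componentB sing_mapU !componentU one_subU.
Qed.

Definition deck_sing n (k : int) (s : sing R Xt n) : sing R Xt n := sing_push (deck phi_bij k) s.

Lemma deck_sing0 n (s : sing R Xt n) : deck_sing 0 s = s.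
Proof. by apply/continuousEP => p /=; rewrite /deck /= addr0; case: (s p). Qed.

Lemma deck_singD n j k (s : sing R Xt n) : deck_sing j (deck_sing k s) = deck_sing (j + k) s.
Proof.
by apply/continuousEP => p /=; rewrite /deck /= perm_powD rmorphD /= -addrA [j%:~R + _]addrC.
Qed.

Lemma sub_deckU n (s : sing R Xt n) : sub_deck << s >> = << s >> - << deck_sing 1 s >>.
Proof. by rewrite /sub_deck sing_mapU. Qed.

Lemma push_deck n k (s : sing R Xt n) :
  sing_push (covering_map phi_bij) (deck_sing k s) = sing_push (covering_map phi_bij) s.
Proof. by apply/continuousEP => p /=; apply/esym/covering_mapP; exists k. Qed.

Lemma push_sub_deck n c : push n (sub_deck c) = 0.
Proof.
move: c; apply: freeg_ext => [x y|x y|s]; [by rewrite sub_deckB raddfB| by rewrite subr0|].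
by rewrite sub_deckU raddfB /= !sing_mapU push_deck subrr.
Qed.

(** An equivariant map from simplices to the integers: it shows that the deck group acts freely on
    them and singles out one lift, of level 0, in each orbit. *)
Definition level n (s : sing R Xt n) : int := Num.floor (s (vertex R ord0)).1.

Lemma level_deck n k (s : sing R Xt n) : level (deck_sing k s) = level s + k.
Proof. by rewrite /level /= floorDrz ?intr_int // intrKfloor. Qed.

(* A retraction K of 1 - t: K (1 - t) = 1, and (1 - t) K = 1 - s pi, where pi is the
   projection to the chains of Y and s is its section by the lifts of level 0. *)
Definition deck_integral n (c : Ct n) : Ct n := free_map (fun s =>
  - signed_sum (fun i => << deck_sing (i - level s) s >>) (level s)) c.

Lemma deck_integralB n : zmod_morphism (@deck_integral n). Proof. exact: raddfB. Qed.

HB.instance Definition _ n :=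
  GRing.isZmodMorphism.Build (Ct n) (Ct n) (@deck_integral n) (@deck_integralB n).

Lemma deck_integralU n (s : sing R Xt n) : deck_integral << s >> =
  - signed_sum (fun i => << deck_sing (i - level s) s >>) (level s).
Proof. exact: free_mapU. Qed.

Lemma deck_integral_sub_deck n : cancel (@sub_deck n) (@deck_integral n).
Proof.
apply: freeg_ext => [x y|//|s]; first by rewrite sub_deckB deck_integralB.
rewrite sub_deckU deck_integralB !deck_integralU level_deck.
(* Terms are indexed by level, so s and its translate have the same summands and only the limits of
   summation differ, by one. *)
have -> : (fun i => << deck_sing (i - (level s + 1)) (deck_sing 1 s) >> : Ct n) =
   (fun i => << deck_sing (i - level s) s >>).
  by apply/funext => i; rewrite deck_singD; congr << deck_sing _ _ >>; lia.
by rewrite signed_sumS subrr deck_sing0 opprK addKr.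
Qed.

Definition lift_sing n (s : sing R Y n) : sing R Xt n := sval (cid (simplex_lift s)).

Lemma lift_singK n (s : sing R Y n) : sing_push (covering_map phi_bij) (lift_sing s) = s.
Proof. by apply/continuousEP => p /=; rewrite /lift_sing; case: cid => t /= ->. Qed.

Definition normal_lift n (s : sing R Y n) : sing R Xt n :=
  deck_sing (- level (lift_sing s)) (lift_sing s).

Definition lift_map n (c : C n) : Ct n := free_map (fun s => << normal_lift s >>) c.

Lemma lift_mapB n : zmod_morphism (@lift_map n). Proof. exact: raddfB. Qed.

HB.instance Definition _ n :=
  GRing.isZmodMorphism.Build (C n) (Ct n) (@lift_map n) (@lift_mapB n).

Lemma lift_mapK n : cancel (@lift_map n) (push n).
Proof.
apply: freeg_ext => [x y|//|s]; first by rewrite !raddfB.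
by rewrite /lift_map free_mapU sing_mapU push_deck lift_singK.
Qed.

(** By uniqueness of lifts the chosen lift is a translate of s, and normalising the level removes
    the choice. *)
Lemma normal_lift_push n (s : sing R Xt n) :
  normal_lift (sing_push (covering_map phi_bij) s) = deck_sing (- level s) s.
Proof.
rewrite /normal_lift; set t := lift_sing _.
have [k tk] : exists k, t =1 deck phi_bij k \o s.
  apply: simplex_lift_unique => p.
  by have /continuousEP/(_ p) /= := lift_singK (sing_push (covering_map phi_bij) s).
have -> : t = deck_sing k s by apply/continuousEP.
by rewrite level_deck deck_singD; congr (deck_sing _ _); lia.
Qed.

(** The sum telescopes between s and its translate of level 0, which is the normal lift of its
    image. *)
Lemma sub_deck_integral n (c : Ct n) : sub_deck (deck_integral c) = c - lift_map (push n c).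
Proof.
move: c; apply: freeg_ext => [x y||s]; first by rewrite !raddfB.
  by apply: zmod_morphism_sub => // x y; rewrite !raddfB.
rewrite deck_integralU sing_mapU /lift_map free_mapU normal_lift_push raddfN /=.
rewrite (signed_sum_additive _ _ (@sub_deckB n)).
have -> : @sub_deck n \o (fun i => << deck_sing (i - level s) s >>) =
    (fun i => << deck_sing (i - level s) s >> - << deck_sing (i + 1 - level s) s >>).
  apply/funext => i /=; rewrite sub_deckU deck_singD; congr (_ - << deck_sing _ _ >>); lia.
rewrite (signed_sum_telescope (fun i => << deck_sing (i - level s) s >>)).
by rewrite subrr deck_sing0 sub0r opprB.
Qed.

Lemma push_eq0 n (c : Ct n) : push n c = 0 -> exists e, c = sub_deck e.
Proof.
by move=> c0; exists (deck_integral c); rewrite sub_deck_integral c0 raddf0 subr0.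
Qed.

Lemma push_surj n (c : C n) : exists e, push n e = c.
Proof. by exists (lift_map c); rewrite lift_mapK. Qed.
End CoveringHomology.

Section FreeOrbits.
Variables (X : choiceType) (phi : X -> X) (phi_bij : bijective phi).

Definition orbit_map (a : {freeg X}) : {freeg (orbits phi_bij)} :=
  free_map (fun x => << orbit_of phi_bij x >>) a.

Lemma orbit_mapB : zmod_morphism orbit_map. Proof. exact: raddfB. Qed.

HB.instance Definition _ :=
  GRing.isZmodMorphism.Build {freeg X} {freeg (orbits phi_bij)} orbit_map orbit_mapB.

Lemma orbit_mapU x : orbit_map << x >> = << orbit_of phi_bij x >>.
Proof. exact: free_mapU. Qed.

Lemma orbit_of_val (o : orbits phi_bij) : orbit_of phi_bij (val o) = o.
Proof. by apply: val_inj; exact: (eqP (valP o)). Qed.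

Lemma orbit_map_val : cancel (free_map (fun o : orbits phi_bij => << val o >>)) orbit_map.
Proof.
apply: freeg_ext => [x y|//|o]; first by rewrite !raddfB.
by rewrite /= free_mapU orbit_mapU orbit_of_val.
Qed.

Lemma orbit_map_one_sub a : orbit_map (one_sub phi a) = 0.
Proof.
move: a; apply: freeg_ext => [x y|x y|x]; first by rewrite one_subB orbit_mapB.
  by rewrite subr0.
rewrite one_subU raddfB /= !orbit_mapU; apply/eqP; rewrite subr_eq0; apply/eqP.
by congr << _ >>; apply: val_inj; rewrite /= orbit_rep_phi.
Qed.

Lemma one_sub_free_homotopy a : one_sub phi (free_map (orbit_homotopy phi_bij) a) =
  a - free_map (fun o : orbits phi_bij => << val o >>) (orbit_map a).
Proof.
move: a; apply: freeg_ext => [x y||x]; first by rewrite raddfB one_subB.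
  by apply: zmod_morphism_sub => // x y; rewrite orbit_mapB raddfB.
by rewrite free_mapU one_sub_homotopy orbit_mapU free_mapU.
Qed.

Lemma free_homotopy_one_sub a : free_map (orbit_homotopy phi_bij) (one_sub phi a) =
  a - free_map (@orbit_cycle _ _ phi_bij) (free_map (orbit_count phi_bij) a).
Proof.
move: a; apply: freeg_ext => [x y||x]; first by rewrite one_subB raddfB.
  by apply: zmod_morphism_sub => // x y; rewrite !raddfB.
by rewrite one_subU raddfB /= !free_mapU homotopy_one_sub.
Qed.

Lemma one_sub_free_cycle g : one_sub phi (free_map (@orbit_cycle _ _ phi_bij) g) = 0.
Proof.
move: g; apply: freeg_ext => [x y|x y|o]; first by rewrite raddfB one_subB.
  by rewrite subr0.
by rewrite free_mapU one_sub_cycle.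
Qed.

Lemma free_count_cycle :
  cancel (free_map (@orbit_cycle _ _ phi_bij)) (free_map (orbit_count phi_bij)).
Proof.
apply: freeg_ext => [x y|//|o]; first by rewrite !raddfB.
by rewrite free_mapU orbit_count_cycle.
Qed.
End FreeOrbits.

Lemma boundaries_cycles (C : chain_complex) n : {subset image_of (bd C n) <= cycles C n}.
Proof.
case: n => [|n] x // /asboolP[y ->].
by rewrite unfold_in /cycles /= bd_bd.
Qed.

Section HomotopyOrbitsHomology.
Variables (R : realType) (X : choiceType) (phi : X -> X) (phi_bij : bijective phi).

Notation Xt := (EZ_times R X).
Notation Y := (homotopy_orbits R phi_bij).
Notation dt := (@sing_bd R Xt).
Notation dY := (@sing_bd R Y).
Notation push := (@push R X phi phi_bij _).

(** A chain of Y is lifted and its components are sent to their orbits. The degree is recorded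
    because it identifies the reduced homology later. *)
Lemma homotopy_orbits_H0 :
  exists2 F : {additive singular_homology R Y 0 -> {freeg (orbits phi_bij)}}, bijective F &
  forall x (Ax : x \in cycles (singular_complex R Y) 0),
    deg (F (subquotient_class (image_of (bd (singular_complex R Y) 0)) Ax)) = deg x.
Proof.
have [||||||F Fb FP] := @bijective_subquotient _ {freeg (orbits phi_bij)}
  (cycles (singular_complex R Y) 0) (image_of (bd (singular_complex R Y) 0))
  (fun z g => exists2 c, push c = z & orbit_map phi_bij (component c) = g).
- exact: boundaries_cycles.
- by move=> _ _ _ _ [c <- <-] [e <- <-]; exists (c - e); rewrite !raddfB.
- move=> u _; have [c cu] := push_surj u.
  by exists (orbit_map phi_bij (component c)), c.
- move=> g; pose c := base_points R (free_map (fun o : orbits phi_bij => << val o >>) g).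
  by exists (push c) => //; exists c => //; rewrite base_pointsK orbit_map_val.
- move=> _ _ /asboolP[u ->] [c cu <-].
  have [e eu] := push_surj u.
  have /push_eq0[w cE] : push (c - dt 0 e) = 0.
    by rewrite raddfB /= -push_bd eu cu subrr.
  rewrite -[c](subrK (dt 0 e)) cE raddfD /= component_bd addr0 component_sub_deck.
  exact: orbit_map_one_sub.
- move=> _ _ [c <- c0]; apply/asboolP.
  (* Subtracting [1 - t] applied to a lift of b leaves the image in Y unchanged and kills the
     component, so that the lift becomes a boundary. *)
  pose b := free_map (orbit_homotopy phi_bij) (component c).
  have [|e eE] := @acyclic0 R X (c - sub_deck phi_bij (base_points R b)).
    rewrite raddfB /= component_sub_deck base_pointsK one_sub_free_homotopy c0.
    by rewrite raddf0 subr0 subrr.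
  exists (push e); rewrite /= push_bd -eE raddfB /= push_sub_deck.
  by rewrite subr0.
exists F => // x Ax; have [c <- <-] := FP x Ax.
move: c; apply: freeg_ext => [u v|u v|s]; rewrite ?raddfB //.
by rewrite componentU orbit_mapU /= sing_mapU !degU.
Qed.

(** The relation is the connecting homomorphism: c lifts the cycle z, its boundary is (1 - t) w, and
    the component of w lies in the kernel of [1 - phi], spanned by the orbit sums. *)
Lemma homotopy_orbits_H1 :
  isomorphic (singular_homology R Y 1) {freeg (finite_orbits phi_bij)}.
Proof.
apply: (@isomorphic_subquotient _ _ _ _ (fun z g => exists c w,
  [/\ push c = z, dt 0 c = sub_deck phi_bij w &
      component w = free_map (@orbit_cycle _ _ phi_bij) g])).
- exact: (@boundaries_cycles (singular_complex R Y) 1).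
- move=> _ g _ g' [c [w [<- cw wg]]] [c' [w' [<- cw' wg']]].
  exists (c - c'), (w - w'); split; first by rewrite raddfB.
    by rewrite raddfB /= cw cw' sub_deckB.
  by rewrite componentB raddfB wg wg'.
- move=> u; rewrite unfold_in /cycles /= => /eqP u0; have [c cu] := push_surj u.
  have /push_eq0[w cw] : push (dt 0 c) = 0 by rewrite -push_bd cu.
  exists (free_map (orbit_count phi_bij) (component w)), c, w; split => //.
  have : one_sub phi (component w) = 0 by rewrite -component_sub_deck -cw component_bd.
  move=> /(congr1 (free_map (orbit_homotopy phi_bij))); rewrite free_homotopy_one_sub raddf0.
  by move/eqP; rewrite subr_eq0 => /eqP.
- move=> g; pose w := base_points R (free_map (@orbit_cycle _ _ phi_bij) g).
  have [|c cw] := @acyclic0 R X (sub_deck phi_bij w).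
    by rewrite component_sub_deck base_pointsK one_sub_free_cycle.
  exists (push c); last by exists c, w; split => //; rewrite base_pointsK.
  by rewrite unfold_in /cycles /= push_bd -cw push_sub_deck.
- move=> _ g /asboolP[u ->] [c [w [cu cw wg]]].
  have [e eu] := push_surj u.
  have /push_eq0[v cv] : push (c - dt 1 e) = 0.
    by rewrite raddfB /= -push_bd eu cu subrr.
  have wv : w = dt 0 v.
    apply: (can_inj (deck_integral_sub_deck phi_bij (n := 0))).
    rewrite -cw -sub_deck_bd -cv raddfB /=.
    by rewrite (sing_bd_bd (T := Xt)) subr0.
  by rewrite -(free_count_cycle g) -wg wv component_bd raddf0.
- move=> _ _ [c [w [<- cw w0]]]; apply/asboolP.
  have [|v wv] := @acyclic0 R X w; first by rewrite w0 raddf0.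
  have [|e eE] := @acyclicS R X 0 (c - sub_deck phi_bij v).
    by rewrite raddfB /= sub_deck_bd -wv cw subrr.
  exists (push e); rewrite /= push_bd -eE raddfB /= push_sub_deck.
  by rewrite subr0.
Qed.

(** Both neighbours in the long exact sequence are homology groups of the covering space in positive
    degrees, hence 0. *)
Lemma homotopy_orbits_H2 n (x : singular_homology R Y n.+2) : x = 0.
Proof.
have [z [Az ->]] := subquotient_classP x; apply/subquotient_class_eq0/asboolP.
move: Az; rewrite unfold_in /cycles /= => /eqP z0.
have [c cz] := push_surj z.
have /push_eq0[w cw] : push (dt n.+1 c) = 0 by rewrite -push_bd cz.
have [|v wv] := @acyclicS R X n w.
  apply: (can_inj (deck_integral_sub_deck phi_bij (n := n))).
  by rewrite -sub_deck_bd -cw raddf0 (sing_bd_bd (T := Xt)).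
have [|e eE] := @acyclicS R X n.+1 (c - sub_deck phi_bij v).
  by rewrite raddfB /= sub_deck_bd -wv cw subrr.
exists (push e); rewrite /= push_bd -eE raddfB /= push_sub_deck.
by rewrite subr0 cz.
Qed.
End HomotopyOrbitsHomology.

(** * Reduced homology *)

Section ReducedHomology.
Variables (R : realType).

Notation sing1 := (sing R one_point).

Lemma sing_one_point n (s t : sing1 n) : s = t.
Proof. by apply/continuousEP => p; case: (s p) (t p) => -[]. Qed.

Definition sing_tt n : sing1 n := cst (tt : one_point).

Lemma alternating_sum_cst (V : lmodType int) m (v : V) :
  \sum_(j < m) (-1) ^+ j *: v = if odd m then v else 0.
Proof.
elim: m => [|m IH]; first by rewrite big_ord0.
rewrite big_ord_recr IH /= -signr_odd; case: (odd m); rewrite /= ?expr0 ?expr1.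
  by rewrite scaleN1r subrr.
by rewrite scale1r add0r.
Qed.

Lemma sing_bd_one_point n (s : sing1 n.+1) :
  @sing_bd R one_point n << s >> = if odd n then << sing_tt n >> else 0.
Proof.
rewrite sing_bdU (eq_bigr (fun j : 'I_n.+2 => (-1) ^+ j *: << sing_tt n >>)) => [|j _].
  by rewrite alternating_sum_cst /= negbK.
by rewrite (sing_one_point (face j s) (sing_tt n)).
Qed.

(** There is one simplex in each dimension and its boundary is alternately 0 and the simplex below,
    so raising the dimension is a contraction in positive degrees. *)
Lemma one_point_homology n (x : singular_homology R one_point n.+1) : x = 0.
Proof.
have [z [Az ->]] := subquotient_classP x; apply/subquotient_class_eq0/asboolP.
have {Az} z0 : @sing_bd R one_point n z = 0 by move: Az; rewrite unfold_in => /eqP.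
pose P m (c : {freeg (sing1 m)}) : {freeg (sing1 m.+1)} :=
  free_map (fun=> << sing_tt m.+1 >>) c.
have PB m : zmod_morphism (@P m) by exact: raddfB.
suff e : @sing_bd R one_point n.+1 (P _ z) = z - P _ (@sing_bd R one_point n z).
  by exists (P _ z); rewrite [RHS]e z0 /P raddf0 subr0.
move: {z0} z; apply: freeg_ext => [u v||s]; first by rewrite PB raddfB.
  by apply: zmod_morphism_sub => // u v; rewrite raddfB PB.
rewrite {1}/P free_mapU !sing_bd_one_point /= (sing_one_point s (sing_tt _)).
case: (odd n); first by rewrite /= /P free_mapU subrr.
by rewrite /= /P raddf0 subr0.
Qed.

Variable T : topologicalType.

Lemma reduced_homologyS n :
  isomorphic (reduced_homology R T n.+1) (singular_homology R T n.+1).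
Proof.
pose A := kernel_of (homology_map (singular_map R (to_point T)) n.+1).
have At x : x \in A by rewrite inE; apply/eqP; apply: one_point_homology.
by apply: (@isomorphic_can (subgroup A) _ val (fun x => Subgroup (At x))) => // x; apply: val_inj.
Qed.

Lemma reduced_homology_trivial n :
  (forall x : singular_homology R T n, x = 0) -> forall x : reduced_homology R T n, x = 0.
Proof. by move=> H0 x; apply: val_inj; rewrite [LHS]H0 raddf0. Qed.

(** For a point, 0-chains are multiples of one simplex and 1-simplices have boundary 0, so the
    degree decides whether a class dies. *)
Lemma mem_reduced_homology0 x (Ax : x \in cycles (singular_complex R T) 0) :
  subquotient_class (image_of (bd (singular_complex R T) 0)) Ax
    \in kernel_of (homology_map (singular_map R (to_point T)) 0) = (deg x == 0).
Proof.
rewrite inE /= /homology_map subquotient_mapE; last exact: chain_map_boundaries.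
set y := singular_map R (to_point T) 0 x.
have yx : deg y = deg x.
  rewrite /y /=; move: {Ax y} x; apply: freeg_ext => [u v|u v|s]; rewrite ?raddfB //.
  by rewrite sing_mapU !degU.
have yE : y = << sing_tt 0 >> *~ deg y.
  move: (y); apply: freeg_ext => [//|u v|s]; first by rewrite raddfB mulrzBr.
  by rewrite degU (sing_one_point s (sing_tt 0)).
apply/eqP/eqP => [/subquotient_class_eq0/asboolP[c yc]|x0].
  rewrite -yx yc; move: {yc} c; apply: freeg_ext => [u v|u v|s]; rewrite ?raddfB ?subr0 //.
  by rewrite sing_bd_one_point raddf0.
apply/subquotient_class_eq0; rewrite -/y yE yx x0 mulr0z; exact: rpred0.
Qed.

Definition punctured (K : choiceType) (k0 : K) : choiceType := {k : K | k != k0}.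

(** The kernel of the degree on a free group is free on the differences with a fixed basis element
    [k0]. *)
Lemma reduced_homology0 (K : choiceType) (k0 : K)
    (F : {additive singular_homology R T 0 -> {freeg K}}) :
  bijective F ->
  (forall x (Ax : x \in cycles (singular_complex R T) 0),
    deg (F (subquotient_class (image_of (bd (singular_complex R T) 0)) Ax)) = deg x) ->
  isomorphic (reduced_homology R T 0) {freeg (punctured k0)}.
Proof.
move=> [G FK GK] Fdeg.
have kerE c : c \in kernel_of (homology_map (singular_map R (to_point T)) 0) = (deg (F c) == 0).
  by have [x [Ax ->]] := subquotient_classP c; rewrite mem_reduced_homology0 Fdeg.
pose j := free_map (fun k : punctured k0 => << val k >> - << k0 >> : {freeg K}).
pose q := free_map (fun k : K => if insub k is Some l then << l >> else 0 : {freeg (punctured k0)}).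
have jB : zmod_morphism j by exact: raddfB.
have qB : zmod_morphism q by exact: raddfB.
have deg_j g : deg (j g) = 0.
  move: g; apply: freeg_ext => [u v|u v|k]; rewrite ?jB ?raddfB ?subr0 //.
  by rewrite /j free_mapU raddfB /= !degU.
have qK g : q (j g) = g.
  move: g; apply: freeg_ext => [u v|//|k]; first by rewrite jB qB.
  rewrite /j free_mapU qB /q !free_mapU valK insubN ?subr0 //.
  by rewrite eqxx.
have jK g : j (q g) = g - << k0 >> *~ deg g.
  move: g; apply: freeg_ext => [u v||k]; first by rewrite qB jB.
    by apply: zmod_morphism_sub => // u v; rewrite raddfB mulrzBr.
  rewrite /q free_mapU degU; case: insubP => [l _ <-|]; first by rewrite /j free_mapU.
  by rewrite negbK => /eqP->; rewrite /j raddf0 subrr.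
apply: (@isomorphic_rel _ _ (fun u g => F (val u) = j g)).
- by move=> u g u' g' ug ug'; rewrite !raddfB ug ug' jB.
- move=> u; exists (q (F (val u))); rewrite jK.
  by have := valP u; rewrite kerE => /eqP->; rewrite mulr0z subr0.
- move=> g; have Gg : G (j g) \in kernel_of (homology_map (singular_map R (to_point T)) 0).
    by rewrite kerE GK deg_j.
  by exists (Subgroup Gg); rewrite /= GK.
- by move=> g; rewrite !raddf0 => j0; rewrite -(qK g) -j0 /q raddf0.
- by move=> u; rewrite /j raddf0 => u0; apply: val_inj; apply: (can_inj FK); rewrite u0 !raddf0.
Qed.
End ReducedHomology.

(** * The rack complex *)

Section RackOperators.
Variables (X : choiceType) (phi : X -> X) (phi_bij : bijective phi).

Notation word n := (word (permutation_rack phi_bij) n).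
Notation C n := {freeg (word n)}.
Notation d := (rack_bd (permutation_rack phi_bij)).

Definition cons_word n (x : X) (w : word n) : word n.+1 :=
  [ffun i => if unlift ord0 i is Some j then w j else x].

Definition behead_word n (w : word n.+1) : word n := [ffun i => w (lift ord0 i)].

Definition phi_word n (w : word n) : word n := [ffun i => phi (w i)].

Lemma cons_word0 n x (w : word n) : cons_word x w ord0 = x.
Proof. by rewrite ffunE unlift_none. Qed.

Lemma cons_wordS n x (w : word n) i : cons_word x w (lift ord0 i) = w i.
Proof. by rewrite ffunE liftK. Qed.

Lemma cons_word_eta n (w : word n.+1) : cons_word (w ord0) (behead_word w) = w.
Proof. by apply/ffunP => i; rewrite ffunE; case: unliftP => [j ->|->] //; rewrite ffunE. Qed.

Lemma behead_cons_word n x (w : word n) : behead_word (cons_word x w) = w.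
Proof. by apply/ffunP => i; rewrite ffunE cons_wordS. Qed.

Lemma phi_cons_word n x (w : word n) : phi_word (cons_word x w) = cons_word (phi x) (phi_word w).
Proof. by apply/ffunP => i; rewrite !ffunE; case: unliftP => // j _; rewrite ffunE. Qed.

Lemma face0_cons_word n x (w : word n) : rack_face0 ord0 (cons_word x w) = w.
Proof. by apply/ffunP => i; rewrite ffunE cons_wordS. Qed.

Lemma face1_cons_word n x (w : word n) : rack_face1 ord0 (cons_word x w) = phi_word w.
Proof. by apply/ffunP => i; rewrite !ffunE /= liftK. Qed.

Lemma lift_lift0 n (k : 'I_n.+1) (i : 'I_n) :
  lift (lift ord0 k) (lift ord0 i) = lift ord0 (lift k i).
Proof. by apply: val_inj; rewrite /= /bump /= !add1n ltnS addnS. Qed.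

Lemma lift_lift_ord0 n (k : 'I_n.+1) : lift (lift ord0 k) ord0 = ord0 :> 'I_n.+2.
Proof. exact: val_inj. Qed.

Lemma face0S_cons_word n x (w : word n.+1) k :
  rack_face0 (lift ord0 k) (cons_word x w) = cons_word x (rack_face0 k w).
Proof.
apply/ffunP => i; rewrite ffunE [RHS]ffunE; case: unliftP => [j ->|->].
  by rewrite lift_lift0 cons_wordS ffunE.
by rewrite lift_lift_ord0 cons_word0.
Qed.

Lemma face1S_cons_word n x (w : word n.+1) k :
  rack_face1 (lift ord0 k) (cons_word x w) = cons_word x (rack_face1 k w).
Proof.
apply/ffunP => i; rewrite ffunE [RHS]ffunE; case: unliftP => [j ->|->].
  by rewrite lift_lift0 !cons_wordS ffunE.
by rewrite lift_lift_ord0 cons_word0.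
Qed.

Definition lam n (a : {freeg X}) (c : C n) : C n.+1 :=
  free_map2 (fun x w => << cons_word x w >>) a c.

HB.instance Definition _ n a := GRing.Additive.copy (@lam n a)
  (free_map2 (fun x w => << cons_word x w >> : C n.+1) a).

Lemma lamBl n (c : C n) : zmod_morphism ((@lam n)^~ c).
Proof. exact: free_map2Bl. Qed.

Lemma lamBr n a : zmod_morphism (@lam n a).
Proof. exact: free_map2Br. Qed.

Lemma lamU n x (w : word n) : lam << x >> << w >> = << cons_word x w >>.
Proof. exact: free_map2U. Qed.

Lemma lam0l n (c : C n) : lam 0 c = 0.
Proof. by rewrite -(subrr 0) lamBl subrr. Qed.

Lemma lam0r n a : lam a 0 = 0 :> C n.+1.
Proof. exact: raddf0. Qed.

Lemma lamNl n a (c : C n) : lam (- a) c = - lam a c.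
Proof. by rewrite -sub0r lamBl lam0l sub0r. Qed.

Lemma lamDl n a b (c : C n) : lam (a + b) c = lam a c + lam b c.
Proof. by rewrite -{1}[b]opprK lamBl lamNl opprK. Qed.

Definition phi_map n (c : C n) : C n := free_map (fun w => << phi_word w >>) c.

Lemma phi_mapB n : zmod_morphism (@phi_map n).
Proof. exact: raddfB. Qed.

Lemma phi_mapU n (w : word n) : phi_map << w >> = << phi_word w >>.
Proof. exact: free_mapU. Qed.

Lemma word_ext n (V : zmodType) (f g : C n.+1 -> V) :
  zmod_morphism f -> zmod_morphism g ->
  (forall x w, f (lam << x >> << w >>) = g (lam << x >> << w >>)) -> f =1 g.
Proof.
move=> fB gB fg; apply: freeg_ext => // w; have := fg (w ord0) (behead_word w).
by rewrite lamU cons_word_eta.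
Qed.

Lemma phi_map_lam n x (c : C n) : phi_map (lam << x >> c) = lam << phi x >> (phi_map c).
Proof.
move: c; apply: freeg_ext => [u v|u v|w]; first by rewrite lamBr phi_mapB.
  by rewrite phi_mapB lamBr.
by rewrite phi_mapU !lamU phi_mapU phi_cons_word.
Qed.

Lemma rack_bd0 (c : C 1) : d 0 c = 0.
Proof.
move: c; apply: freeg_ext => [u v|u v|w]; rewrite ?raddfB ?subr0 //.
by rewrite rack_bdU big_ord1 (_ : rack_face1 _ _ = rack_face0 ord0 w) ?subrr ?scaler0 //;
  apply/ffunP => -[].
Qed.

Lemma phi_map0 (c : C 0) : phi_map c = c.
Proof.
move: c; apply: freeg_ext => [u v|//|w]; first by rewrite phi_mapB.
by rewrite phi_mapU; congr << _ >>; apply/ffunP => -[].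
Qed.

(** The two faces at the first letter give [1 - phi]. The others commute with prepending x, as the
    rack operation changes only letters to the right of the deleted one; the index shift gives the
    sign. *)
Lemma rack_bd_lamU n x (c : C n.+1) :
  d n.+1 (lam << x >> c) = c - phi_map c - lam << x >> (d n c).
Proof.
move: c; apply: freeg_ext => [u v||w]; first by rewrite lamBr raddfB.
  apply: zmod_morphism_sub => [|u v]; last by rewrite raddfB lamBr.
  by apply: zmod_morphism_sub => // u v; rewrite phi_mapB.
rewrite lamU rack_bdU big_ord_recl /= expr0 scale1r face0_cons_word face1_cons_word phi_mapU.
congr (_ + _); rewrite rack_bdU (raddf_sum (lam << x >>)) -sumrN; apply: eq_bigr => k _.
rewrite face0S_cons_word face1S_cons_word /bump /= add1n exprS mulN1r scaleNr.
by rewrite (additiveZ (lam << x >>)) /= lamBr !lamU.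
Qed.

Lemma rack_bd_lam n a (c : C n.+1) :
  d n.+1 (lam a c) = (c - phi_map c) *~ deg a - lam a (d n c).
Proof.
move: a; apply: freeg_ext => [u v||x]; first by rewrite lamBl raddfB.
  apply: zmod_morphism_sub => u v; first by rewrite raddfB mulrzBr.
  by rewrite lamBl.
by rewrite rack_bd_lamU degU.
Qed.

Lemma rack_bd_lam_deg0 n a (c : C n.+1) : deg a = 0 -> d n.+1 (lam a c) = - lam a (d n c).
Proof. by rewrite rack_bd_lam => ->; rewrite mulr0z sub0r. Qed.

Variable x0 : X.

(** Up to terms with the boundary of c, lam_x0 lam_x c has boundary lam_x c - lam_(phi x) (phi c) -
    lam_x0 (c - phi c). The second summand, with a left factor of degree 0, is chosen so that its
    boundary turns phi c into c and cancels the terms in lam_x0. *)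
Definition mu n (a : {freeg X}) (c : C n) : C n.+2 :=
  free_map2 (fun x w => << cons_word x0 (cons_word x w) >>
    + (<< cons_word (phi x) (cons_word x0 w) >> - << cons_word x0 (cons_word x0 w) >>)) a c.

HB.instance Definition _ n a := GRing.Additive.copy (@mu n a)
  (free_map2 (fun x w => << cons_word x0 (cons_word x w) >>
    + (<< cons_word (phi x) (cons_word x0 w) >> - << cons_word x0 (cons_word x0 w) >>) : C n.+2) a).

Lemma muBl n (c : C n) : zmod_morphism ((@mu n)^~ c).
Proof. exact: free_map2Bl. Qed.

Lemma muBr n a : zmod_morphism (@mu n a).
Proof. exact: free_map2Br. Qed.

Lemma mu0l n (c : C n) : mu 0 c = 0.
Proof. by rewrite -(subrr 0) muBl subrr. Qed.

Lemma mu0r n a : mu a 0 = 0 :> C n.+2.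
Proof. exact: raddf0. Qed.

Lemma muE n x (c : C n) : mu << x >> c =
  lam << x0 >> (lam << x >> c) + lam (<< phi x >> - << x0 >>) (lam << x0 >> c).
Proof.
move: c; apply: freeg_ext => [u v|u v|w]; first by rewrite muBr.
  by rewrite !lamBr !opprD addrACA.
by rewrite /mu free_map2U !lamU lamBl !lamU.
Qed.

Lemma rack_bd_mu0 a (c : C 0) : d 1 (mu a c) = lam (one_sub phi a) c.
Proof.
move: a; apply: freeg_ext => [u v|u v|x]; first by rewrite muBl raddfB.
  by rewrite one_subB lamBl.
rewrite muE (raddfD (d _)) rack_bd_lamU.
rewrite (@rack_bd_lam_deg0 _ (<< phi x >> - << x0 >>)); last by rewrite degB !degU subrr.
by rewrite !rack_bd0 !lam0r oppr0 !addr0 phi_map_lam phi_map0 one_subU lamBl.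
Qed.

Lemma rack_bd_mu n a (c : C n.+1) :
  d n.+2 (mu a c) = lam (one_sub phi a) c + mu a (d n c).
Proof.
move: a; apply: freeg_ext => [u v|u v|x]; first by rewrite muBl raddfB.
  by rewrite one_subB lamBl muBl opprD addrACA.
rewrite muE (raddfD (d _)) rack_bd_lamU.
rewrite (@rack_bd_lam_deg0 _ (<< phi x >> - << x0 >>)); last by rewrite degB !degU subrr.
rewrite !rack_bd_lamU phi_map_lam one_subU muE !lamBl !lamBr.
rewrite !opprB !opprD !opprK !addrA.
by rewrite [LHS](ACl (1*6*3*8*9*(2*7)*(4*10)*(5*11))) /= !addNr subrr !addr0.
Qed.
End RackOperators.

Section TwoStep.
Variables (T : nat -> Type) (t0 : T 0) (t1 : T 1).
Variable step : forall n, T n -> T n.+1 -> T n.+2.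

(** Splitting off a first factor shortens a chain by one letter or by two, so the recursions below
    need the two preceding values. *)
Fixpoint two_step_pair n : T n * T n.+1 :=
  if n is m.+1 then ((two_step_pair m).2, step (two_step_pair m).1 (two_step_pair m).2)
  else (t0, t1).

Definition two_step n : T n := (two_step_pair n).1.
End TwoStep.

Lemma two_step_ind (P : nat -> Prop) :
  P 0 -> P 1 -> (forall n, P n -> P n.+1 -> P n.+2) -> forall n, P n.
Proof.
move=> P0 P1 PS n; suff: P n /\ P n.+1 by case.
by elim: n => // n [Pn PnS]; split=> //; apply: PS.
Qed.

Section RackHomology.
Variables (X : choiceType) (phi : X -> X) (phi_bij : bijective phi).
Variable s0 : orbits phi_bij.

Notation word n := (word (permutation_rack phi_bij) n).
Notation C n := {freeg (word n)}.
Notation d := (rack_bd (permutation_rack phi_bij)).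
Let x0 : X := val s0.
Notation lam := (@lam X phi phi_bij _).
Notation mu := (@mu X phi phi_bij x0 _).
Let B0 := punctured s0.
Let B1 := finite_orbits phi_bij.

Lemma orbit_rep_x0 : orbit_rep phi_bij x0 = x0.
Proof. exact: (eqP (valP s0)). Qed.

Section Extension.
Variables (V : zmodType) (n : nat).
Variables (f : X -> {additive C n.+1 -> V}) (g : X -> {additive C n -> V}).

(* The map taking the values f x u on lam (x - x0) u and g x w on mu x w. *)
Definition rack_extend : C n.+2 -> V := free_map (fun w : word n.+2 =>
  let x := w ord0 in let y := w (lift ord0 ord0) in let v := behead_word (behead_word w) in
  f x << cons_word y v >> + g y << v >> - f (phi y) << cons_word x0 v >>).

HB.instance Definition _ := GRing.Additive.on rack_extend.

Hypothesis f0 : forall u, f x0 u = 0.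

Lemma rack_extendB : zmod_morphism rack_extend. Proof. exact: raddfB. Qed.

Lemma rack_extendD u v : rack_extend (u + v) = rack_extend u + rack_extend v.
Proof. exact: raddfD. Qed.

(** The three terms mirror lam_x lam_y w = lam_(x - x0) lam_y w + mu_y w - lam_(phi y - x0) lam_x0
    w. *)
Lemma rack_extendU x y (w : C n) : rack_extend (lam << x >> (lam << y >> w)) =
  f x (lam << y >> w) + g y w - f (phi y) (lam << x0 >> w).
Proof.
move: w; apply: freeg_ext => [u v||w]; first by rewrite !lamBr rack_extendB.
  apply: zmod_morphism_sub => u v; last by rewrite lamBr raddfB.
  by rewrite lamBr !raddfB /= addrACA opprD.
by rewrite !lamU /rack_extend free_mapU cons_word0 cons_wordS cons_word0 !behead_cons_word.
Qed.

Lemma rack_extend_lam a u : rack_extend (lam a u) =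
  free_map (fun x => f x u) a + rack_extend (lam << x0 >> u) *~ deg a.
Proof.
move: a; apply: freeg_ext => [b c|b c|x]; first by rewrite lamBl rack_extendB.
  by rewrite raddfB raddfB mulrzBr opprD addrACA.
rewrite free_mapU degU mulr1z; move: u; apply: word_ext => [b c|b c|y w].
- by rewrite lamBr rack_extendB.
- by rewrite raddfB lamBr rack_extendB opprD addrACA.
- by rewrite !rack_extendU f0 add0r addrA.
Qed.

Lemma rack_extend_lam_deg0 a u : deg a = 0 -> rack_extend (lam a u) = free_map (fun x => f x u) a.
Proof. by rewrite rack_extend_lam => ->; rewrite mulr0z addr0. Qed.

Lemma rack_extend_mu a u : rack_extend (mu a u) = free_map (fun x => g x u) a.
Proof.
move: a; apply: freeg_ext => [b c|b c|x]; first by rewrite muBl rack_extendB.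
  by rewrite raddfB.
rewrite muE lamBl free_mapU rack_extendD rack_extendB !rack_extendU !f0 !add0r.
by rewrite -[_ + g x0 u - _]addrA addrK subrK.
Qed.
End Extension.

Lemma rack_ext2 (V : zmodType) n (f g : C n.+2 -> V) :
  zmod_morphism f -> zmod_morphism g ->
  (forall a u, deg a = 0 -> f (lam a u) = g (lam a u)) ->
  (forall a u, f (mu a u) = g (mu a u)) -> f =1 g.
Proof.
move=> /additive_of[F FE] /additive_of[G GE] fgl fgm.
have {fgl} Fl a u : deg a = 0 -> F (lam a u) = G (lam a u) by rewrite FE GE; apply: fgl.
have {fgm} Fm a u : F (mu a u) = G (mu a u) by rewrite FE GE; apply: fgm.
have e : F =1 G; last by move=> u; rewrite -FE -GE e.
have deg2 (x y : X) : deg (<< x >> - << y >>) = 0 by rewrite degB !degU subrr.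
have main x y (w : C n) : F (lam << x >> (lam << y >> w)) = G (lam << x >> (lam << y >> w)).
  rewrite -[<< x >>](subrK << x0 >>) lamDl !raddfD Fl //; congr (_ + _).
  have -> : lam << x0 >> (lam << y >> w) = mu << y >> w -
      lam (<< phi y >> - << x0 >>) (lam << x0 >> w) by rewrite muE addrK.
  by rewrite !raddfB Fm Fl.
by apply: word_ext => [u v|u v|x w]; rewrite ?raddfB //;
  rewrite -(cons_word_eta w) -lamU main.
Qed.

(* Maps on the free group A on X; those that are only used on the kernel of the
   augmentation are normalised at x0. *)
Definition homotopy0 (a : {freeg X}) : {freeg X} :=
  free_map (fun x => orbit_homotopy phi_bij x - orbit_homotopy phi_bij x0) a.

Definition rep_part (a : {freeg X}) : {freeg X} :=
  free_map (fun x => << orbit_rep phi_bij x >> - << x0 >>) a.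

Definition count_part (a : {freeg X}) : {freeg B1} := free_map (orbit_count phi_bij) a.

Definition cycle_part (g : {freeg B1}) : {freeg X} := free_map (@orbit_cycle _ _ phi_bij) g.

Definition punctured_proj (x : X) : {freeg B0} :=
  if insub (orbit_of phi_bij x) is Some b then << b >> else 0.

Definition punctured_part (a : {freeg X}) : {freeg B0} := free_map punctured_proj a.

Definition difference_part (g : {freeg B0}) : {freeg X} :=
  free_map (fun b : B0 => << val (val b) >> - << x0 >>) g.

Lemma homotopy0B : zmod_morphism homotopy0. Proof. exact: raddfB. Qed.
Lemma rep_partB : zmod_morphism rep_part. Proof. exact: raddfB. Qed.
Lemma count_partB : zmod_morphism count_part. Proof. exact: raddfB. Qed.
Lemma cycle_partB : zmod_morphism cycle_part. Proof. exact: raddfB. Qed.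
Lemma punctured_partB : zmod_morphism punctured_part. Proof. exact: raddfB. Qed.
Lemma difference_partB : zmod_morphism difference_part. Proof. exact: raddfB. Qed.

Lemma punctured_proj0 : punctured_proj x0 = 0.
Proof.
rewrite /punctured_proj insubN // negbK; apply/eqP/val_inj; exact: orbit_rep_x0.
Qed.

Lemma deg_one_sub a : deg (one_sub phi a) = 0.
Proof.
move: a; apply: freeg_ext => [u v|u v|x]; first by rewrite one_subB degB.
  by rewrite subr0.
by rewrite one_subU degB !degU subrr.
Qed.

Lemma deg_difference g : deg (difference_part g) = 0.
Proof.
move: g; apply: freeg_ext => [u v|u v|b]; first by rewrite difference_partB degB.
  by rewrite subr0.
by rewrite /difference_part free_mapU degB !degU subrr.
Qed.

Lemma deg_rep_part a : deg (rep_part a) = 0.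
Proof.
move: a; apply: freeg_ext => [u v|u v|b]; first by rewrite rep_partB degB.
  by rewrite subr0.
by rewrite /rep_part free_mapU degB !degU subrr.
Qed.

Lemma one_sub_homotopy0 a : deg a = 0 -> one_sub phi (homotopy0 a) = a - rep_part a.
Proof.
move=> a0; rewrite -[RHS]subr0 -(mulr0z << x0 >>) -a0; move: {a0} a; apply: freeg_ext => [u v||x].
- by rewrite homotopy0B one_subB.
- apply: zmod_morphism_sub => [|u v]; last by rewrite degB mulrzBr.
  by apply: zmod_morphism_sub => // u v; rewrite rep_partB.
- rewrite /homotopy0 /rep_part !free_mapU one_subB !one_sub_homotopy orbit_rep_x0 subrr subr0.
  by rewrite degU mulr1z opprB addrA addrAC addrK.
Qed.

Lemma homotopy0_one_sub a : homotopy0 (one_sub phi a) = a - cycle_part (count_part a).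
Proof.
move: a; apply: freeg_ext => [u v||x]; first by rewrite one_subB homotopy0B.
  by apply: zmod_morphism_sub => // u v; rewrite count_partB cycle_partB.
rewrite one_subU homotopy0B /homotopy0 /cycle_part /count_part !free_mapU -homotopy_one_sub.
by rewrite opprB addrA subrK.
Qed.

Lemma rep_part_one_sub a : rep_part (one_sub phi a) = 0.
Proof.
move: a; apply: freeg_ext => [u v|u v|x]; first by rewrite one_subB rep_partB.
  by rewrite subr0.
by rewrite one_subU rep_partB /rep_part !free_mapU orbit_rep_phi subrr.
Qed.

Lemma difference_punctured a : difference_part (punctured_part a) = rep_part a.
Proof.
move: a; apply: freeg_ext => [u v|u v|x]; first by rewrite punctured_partB difference_partB.
  by rewrite rep_partB.
rewrite /punctured_part /rep_part !free_mapU /punctured_proj /difference_part.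
case: insubP => [b _ bE|]; first by rewrite free_mapU bE.
by rewrite negbK => /eqP/(congr1 val) /= ->; rewrite raddf0 subrr.
Qed.

Lemma punctured_difference g : punctured_part (difference_part g) = g.
Proof.
move: g; apply: freeg_ext => [u v|//|b]; first by rewrite difference_partB punctured_partB.
rewrite /difference_part free_mapU punctured_partB /punctured_part !free_mapU.
rewrite punctured_proj0 subr0 /punctured_proj.
have -> : orbit_of phi_bij (val (val b)) = val b by apply: val_inj; exact: (eqP (valP (val b))).
by rewrite valK.
Qed.

Lemma punctured_one_sub a : punctured_part (one_sub phi a) = 0.
Proof.
by rewrite -[LHS]punctured_difference difference_punctured rep_part_one_sub /punctured_part raddf0.
Qed.

Lemma one_sub_cycle_part g : one_sub phi (cycle_part g) = 0.
Proof. exact: one_sub_free_cycle. Qed.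

Lemma count_cycle_part g : count_part (cycle_part g) = g.
Proof. exact: free_count_cycle. Qed.
End RackHomology.

(** * The homotopy retraction of the rack complex onto words *)

Section RackContraction.
Variables (X : choiceType) (phi : X -> X) (phi_bij : bijective phi).
Variable s0 : orbits phi_bij.

Notation word n := (word (permutation_rack phi_bij) n).
Notation C n := {freeg (word n)}.
Notation d := (rack_bd (permutation_rack phi_bij)).
Notation x0 := (val s0 : X).
Notation lam := (@lam X phi phi_bij _).
Notation mu := (@mu X phi phi_bij x0 _).
Notation B0 := (punctured s0).
Notation B1 := (finite_orbits phi_bij).
Notation words := (words (orbits phi_bij) B0 B1).

Definition word_basis n : choiceType := {p : nat & words n p}.
Notation W n := {freeg (word_basis n)}.

Definition prepend0 n (b : {freeg B0}) (w : W n.+1) : W n.+2 :=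
  free_map2 (fun b w => << existT (words n.+2) (tag w) (inl (b, tagged w)) >>) b w.

Definition prepend1 n (o : {freeg B1}) (w : W n) : W n.+2 :=
  free_map2 (fun o w => << existT (words n.+2) (tag w).+1 (inr (o, tagged w)) >>) o w.

HB.instance Definition _ n b := GRing.Additive.copy (@prepend0 n b)
  (free_map2 (fun b (w : word_basis n.+1) =>
     << existT (words n.+2) (tag w) (inl (b, tagged w)) >> : W n.+2) b).

HB.instance Definition _ n o := GRing.Additive.copy (@prepend1 n o)
  (free_map2 (fun o (w : word_basis n) =>
     << existT (words n.+2) (tag w).+1 (inr (o, tagged w)) >> : W n.+2) o).

Lemma prepend0Bl n (w : W n.+1) : zmod_morphism ((@prepend0 n)^~ w).
Proof. exact: free_map2Bl. Qed.

Lemma prepend1Bl n (w : W n) : zmod_morphism ((@prepend1 n)^~ w).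
Proof. exact: free_map2Bl. Qed.

Lemma prepend0Br n b : zmod_morphism (@prepend0 n b).
Proof. exact: free_map2Br. Qed.

Lemma prepend1Br n b : zmod_morphism (@prepend1 n b).
Proof. exact: free_map2Br. Qed.

Lemma prepend_ext (V : zmodType) n (f g : W n.+2 -> V) :
  zmod_morphism f -> zmod_morphism g ->
  (forall b w, f (prepend0 b w) = g (prepend0 b w)) ->
  (forall o w, f (prepend1 o w) = g (prepend1 o w)) -> f =1 g.
Proof.
move=> fB gB fg0 fg1; apply: freeg_ext => // -[p [[b w]|c]].
  have := fg0 << b >> << existT (words n.+1) p w >>.
  by rewrite /prepend0 free_map2U.
case: p c => [[]|p [o w]].
have := fg1 << o >> << existT (words n) p w >>.
by rewrite /prepend1 free_map2U.
Qed.

Definition nil_word : word 0 := [ffun=> x0].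

Lemma nil_wordP (w : word 0) : w = nil_word.
Proof. by apply/ffunP => -[]. Qed.

Definition rack_cycle_step n (P : {additive W n -> C n}) (Q : {additive W n.+1 -> C n.+1}) :
    {additive W n.+2 -> C n.+2} :=
  free_map (fun c : word_basis n.+2 => match tagged c with
    | inl bw => lam (difference_part << bw.1 >>) (Q << existT (words n.+1) (tag c) bw.2 >>)
    | inr e => match tag c as p return shift (fun q => (B1 * words n q)%type) p -> C n.+2 with
        | 0 => fun e => match e : void with end
        | q.+1 => fun e => mu (cycle_part << e.1 >>) (P << existT (words n) q e.2 >>)
        end e
    end).

(** A letter of [B0] enters through [lam] as a representative minus [x0], a letter of [B1] through
    [mu] as an orbit sum; a final orbit is kept whole, as every chain of degree 1 is a cycle. *)
Definition rack_cycle : forall n, {additive W n -> C n} :=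
  two_step (T := fun n => {additive W n -> C n})
    (free_map (fun=> << nil_word >>))
    (free_map (fun c : word_basis 1 =>
       match tag c as p return words 1 p -> C 1 with
       | 0 => fun s => lam << val s >> << nil_word >>
       | _ => fun s => match s : void with end
       end (tagged c)))
    rack_cycle_step.

Definition rack_class : forall n, {additive C n -> W n} :=
  two_step (T := fun n => {additive C n -> W n})
    (free_map (fun=> << existT (words 0) 0 tt >>))
    (free_map (fun w : word 1 => << existT (words 1) 0 (orbit_of phi_bij (w ord0)) >>))
    (fun n P Q => rack_extend s0
       (fun x => prepend0 (punctured_proj s0 x) \o Q)
       (fun x => prepend1 (orbit_count phi_bij x) \o P)).

(** The tensor trick: with h the homotopy on the first factor and ip the projection onto its
    homology, this is h times 1 plus ip times the homotopy on the rest. The minus sign is the Koszul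
    sign of the odd [lam]; on [mu] the factor h vanishes. *)
Definition rack_homotopy : forall n, {additive C n -> C n.+1} :=
  two_step (T := fun n => {additive C n -> C n.+1})
    \0
    (free_map (fun w : word 1 => mu (homotopy0 s0 << w ord0 >>) << nil_word >>))
    (fun n P Q => rack_extend s0
       (fun x => mu (homotopy0 s0 << x >>) \- (lam (rep_part s0 << x >>) \o Q))
       (fun x => mu (cycle_part (count_part phi_bij << x >>)) \o P)).

Lemma rack_cycle_prepend0 n b w :
  rack_cycle n.+2 (prepend0 b w) = lam (difference_part b) (rack_cycle n.+1 w).
Proof.
move: b; apply: freeg_ext => [u v|u v|b]; first by rewrite prepend0Bl raddfB.
  by rewrite difference_partB lamBl.
move: w; apply: freeg_ext => [u v|u v|[p w]]; first by rewrite prepend0Br raddfB.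
  by rewrite raddfB lamBr.
by rewrite /prepend0 free_map2U [LHS]free_mapU.
Qed.

Lemma rack_cycle_prepend1 n o w :
  rack_cycle n.+2 (prepend1 o w) = mu (cycle_part o) (rack_cycle n w).
Proof.
move: o; apply: freeg_ext => [u v|u v|o]; first by rewrite prepend1Bl raddfB.
  by rewrite cycle_partB muBl.
move: w; apply: freeg_ext => [u v|u v|[p w]]; first by rewrite prepend1Br raddfB.
  by rewrite raddfB muBr.
by rewrite /prepend1 free_map2U [LHS]free_mapU.
Qed.

Lemma rack_class_lam n a u : deg a = 0 ->
  rack_class n.+2 (lam a u) = prepend0 (punctured_part s0 a) (rack_class n.+1 u).
Proof.
move=> a0; rewrite [LHS]rack_extend_lam_deg0 //; last first.
  by move=> v; rewrite /= punctured_proj0 /prepend0 /free_map2 raddf0.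
move: {a0} a; apply: freeg_ext => [x y|x y|x]; first by rewrite raddfB.
  by rewrite punctured_partB prepend0Bl.
by rewrite free_mapU /punctured_part free_mapU.
Qed.

Lemma rack_class_mu n a u :
  rack_class n.+2 (mu a u) = prepend1 (count_part phi_bij a) (rack_class n u).
Proof.
rewrite [LHS]rack_extend_mu //; last first.
  by move=> v; rewrite /= punctured_proj0 /prepend0 /free_map2 raddf0.
move: a; apply: freeg_ext => [x y|x y|x]; first by rewrite raddfB.
  by rewrite count_partB prepend1Bl.
by rewrite free_mapU /count_part free_mapU.
Qed.

Lemma homotopy0_x0 : homotopy0 s0 << x0 >> = 0.
Proof. by rewrite /homotopy0 free_mapU subrr. Qed.

Lemma rep_part_x0 : rep_part s0 << x0 >> = 0.
Proof. by rewrite /rep_part free_mapU (orbit_rep_x0 s0) subrr. Qed.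

Lemma rack_homotopy_lamS n a u : deg a = 0 -> rack_homotopy n.+2 (lam a u) =
  mu (homotopy0 s0 a) u - lam (rep_part s0 a) (rack_homotopy n.+1 u).
Proof.
move=> a0; rewrite [LHS]rack_extend_lam_deg0 //; last first.
  by move=> v; rewrite /= homotopy0_x0 rep_part_x0 mu0l lam0l subrr.
move: {a0} a; apply: freeg_ext => [x y||x]; first by rewrite raddfB.
  by apply: zmod_morphism_sub => x y; rewrite ?homotopy0B ?muBl ?rep_partB ?lamBl.
by rewrite free_mapU.
Qed.

Lemma rack_homotopy_lam n a u : deg a = 0 -> rack_homotopy n.+1 (lam a u) =
  mu (homotopy0 s0 a) u - lam (rep_part s0 a) (rack_homotopy n u).
Proof.
case: n u => [|n] u a0; last exact: rack_homotopy_lamS.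
rewrite [rack_homotopy 0 u]/(0 : C 1) lam0r subr0.
move: {a0} a; apply: freeg_ext => [x y|x y|x]; first by rewrite lamBl raddfB.
  by rewrite homotopy0B muBl.
move: u; apply: freeg_ext => [x' y|x' y|w]; first by rewrite lamBr raddfB.
  by rewrite muBr.
by rewrite lamU [LHS]free_mapU cons_word0 (nil_wordP w).
Qed.

Lemma rack_homotopy_mu n a u :
  rack_homotopy n.+2 (mu a u) = mu (cycle_part (count_part phi_bij a)) (rack_homotopy n u).
Proof.
rewrite [LHS]rack_extend_mu //; last first.
  by move=> v; rewrite /= homotopy0_x0 rep_part_x0 mu0l lam0l subrr.
move: a; apply: freeg_ext => [x y|x y|x]; first by rewrite raddfB.
  by rewrite count_partB cycle_partB muBl.
by rewrite free_mapU.
Qed.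

Lemma rack_cycleK n (w : W n) : rack_class n (rack_cycle n w) = w.
Proof.
move: n w; apply: two_step_ind => [||n IH0 IH1] w.
- move: w; apply: freeg_ext => [x y|//|[p c]]; first by rewrite !raddfB.
  by rewrite [rack_cycle _ _]free_mapU [LHS]free_mapU; case: p c => // -[].
- move: w; apply: freeg_ext => [x y|//|[p c]]; first by rewrite !raddfB.
  case: p c => [|p []] s; rewrite [rack_cycle _ _]free_mapU /= lamU [LHS]free_mapU cons_word0.
  by rewrite orbit_of_val.
- move: w; apply: prepend_ext => [x y|//|b w|o w]; first by rewrite !raddfB.
    by rewrite rack_cycle_prepend0 rack_class_lam ?deg_difference // punctured_difference IH1.
  by rewrite rack_cycle_prepend1 rack_class_mu count_cycle_part IH0.
Qed.

Lemma rack_bd_cycle n (w : W n.+1) : d n (rack_cycle n.+1 w) = 0.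
Proof.
move: n w; apply: two_step_ind => [w|w|n IH0 IH1 w]; first exact: rack_bd0.
- move: w; apply: prepend_ext => [x y|x y|b w|o w]; rewrite ?raddfB ?subr0 //.
    rewrite rack_cycle_prepend0 rack_bd_lam_deg0 ?deg_difference //.
    by rewrite rack_bd0 lam0r oppr0.
  by rewrite rack_cycle_prepend1 rack_bd_mu0 one_sub_cycle_part lam0l.
- move: w; apply: prepend_ext => [x y|x y|b w|o w]; rewrite ?raddfB ?subr0 //.
    by rewrite rack_cycle_prepend0 rack_bd_lam_deg0 ?deg_difference // IH1 lam0r oppr0.
  by rewrite rack_cycle_prepend1 rack_bd_mu one_sub_cycle_part lam0l IH0 mu0r addr0.
Qed.

Lemma rack_class_bd n (c : C n.+1) : rack_class n (d n c) = 0.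
Proof.
move: n c; apply: two_step_ind => [c|c|n IH0 IH1 c].
- by rewrite rack_bd0 raddf0.
- move: c; apply: word_ext => [u v|u v|x w]; rewrite ?raddfB ?subr0 //.
  rewrite rack_bd_lamU rack_bd0 lam0r subr0 phi_mapU raddfB.
  apply/eqP; rewrite subr_eq0; apply/eqP; rewrite [LHS]free_mapU [RHS]free_mapU ffunE.
  by congr << existT _ _ _ >>; apply: val_inj; rewrite /= orbit_rep_phi.
- move: c; apply: (rack_ext2 (s0 := s0)) => [u v|u v|a u a0|a u]; rewrite ?raddfB ?subr0 //.
    rewrite rack_bd_lam_deg0 // raddfN rack_class_lam // IH1.
    by rewrite /prepend0 raddf0 oppr0.
  rewrite rack_bd_mu raddfD rack_class_lam ?deg_one_sub // rack_class_mu IH0 punctured_one_sub.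
  by rewrite /prepend1 raddf0 addr0 /prepend0 /free_map2 raddf0.
Qed.

Definition rack_homotopy_bd n : C n -> C n :=
  if n is m.+1 then fun c => rack_homotopy m (d m c) else fun=> 0.

Lemma rack_homotopy_bdB n : zmod_morphism (@rack_homotopy_bd n).
Proof. by case: n => [|n] x y; rewrite /= ?subr0 // !raddfB. Qed.

Lemma rack_homotopy_bdS n (c : C n.+1) : rack_homotopy_bd c = rack_homotopy n (d n c).
Proof. by []. Qed.

Lemma rack_cycle_class_lam n a (u : C n.+1) : deg a = 0 ->
  rack_cycle n.+2 (rack_class n.+2 (lam a u)) =
  lam (rep_part s0 a) (rack_cycle n.+1 (rack_class n.+1 u)).
Proof. by move=> a0; rewrite rack_class_lam // rack_cycle_prepend0 difference_punctured. Qed.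

Lemma rack_cycle_class_mu n a (u : C n) :
  rack_cycle n.+2 (rack_class n.+2 (mu a u)) =
  mu (cycle_part (count_part phi_bij a)) (rack_cycle n (rack_class n u)).
Proof. by rewrite rack_class_mu rack_cycle_prepend1. Qed.

(** Two-step induction, in which the first factor contributes [one_sub_homotopy0] on A' and
    [homotopy0_one_sub] on A, and the induction hypothesis is applied under ip. *)
Lemma rack_contraction n (c : C n) :
  c - rack_cycle n (rack_class n c) = d n (rack_homotopy n c) + rack_homotopy_bd c.
Proof.
move: n c; apply: two_step_ind => [c|c|n IH0 IH1 c].
- rewrite rack_bd0 addr0; apply/eqP; rewrite subr_eq0; apply/eqP.
  move: c; apply: freeg_ext => [//|x y|w]; first by rewrite !raddfB.
  by rewrite [rack_class _ _]free_mapU [RHS]free_mapU (nil_wordP w).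
- rewrite [rack_homotopy_bd c]/(0 : C 1) addr0.
  move: c; apply: word_ext => [||x w]; last first.
  + rewrite (nil_wordP w) lamU [rack_class _ _]free_mapU [rack_homotopy _ _]free_mapU.
    rewrite [rack_cycle _ _]free_mapU cons_word0 /= rack_bd_mu0.
    have -> : homotopy0 s0 << x >> = homotopy0 s0 (<< x >> - << x0 >>).
      by rewrite homotopy0B homotopy0_x0 subr0.
    rewrite one_sub_homotopy0; last by rewrite degB !degU subrr.
    rewrite rep_partB rep_part_x0 subr0 /rep_part free_mapU !lamBl -!lamU opprB.
    by rewrite addrA subrK.
  + by move=> u v; rewrite !raddfB.
  + by apply: zmod_morphism_sub => // u v; rewrite !raddfB.
move: c; apply: (rack_ext2 (s0 := s0)) => [|u v|a u a0|a u].
- by apply: zmod_morphism_sub => // u v; rewrite !raddfB.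
- by rewrite rack_homotopy_bdB !raddfB opprD addrACA.
- rewrite rack_cycle_class_lam // rack_homotopy_lam // (raddfB (d _)).
  rewrite rack_bd_mu rack_bd_lam_deg0 ?deg_rep_part // one_sub_homotopy0 // opprK.
  have -> : rack_homotopy_bd (lam a u) =
      - mu (homotopy0 s0 a) (d n u) + lam (rep_part s0 a) (rack_homotopy_bd u).
    by rewrite rack_homotopy_bdS rack_bd_lam_deg0 // raddfN rack_homotopy_lam // opprB addrC.
  have := congr1 (lam (rep_part s0 a)) (IH1 u).
  rewrite lamBr (raddfD (lam _)) => e.
  rewrite lamBl !addrA [RHS](ACl (1*2*(4*6)*(3*5))) /= -e subrr addr0.
  by rewrite addrA subrK.
- rewrite rack_cycle_class_mu rack_homotopy_mu rack_bd_mu one_sub_cycle_part lam0l add0r.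
  have -> : rack_homotopy_bd (mu a u) = (mu a u - mu (cycle_part (count_part phi_bij a)) u) +
      mu (cycle_part (count_part phi_bij a)) (rack_homotopy_bd u).
    (* A chain u of degree 0 is separate: the boundary of [mu a u] then has no term with the
       boundary of u. *)
    rewrite rack_homotopy_bdS; case: n {IH0 IH1} u => [|n] u.
      rewrite rack_bd_mu0 rack_homotopy_lam ?deg_one_sub // rep_part_one_sub lam0l subr0.
      by rewrite homotopy0_one_sub muBl mu0r addr0.
    rewrite rack_bd_mu raddfD rack_homotopy_lam ?deg_one_sub // rep_part_one_sub lam0l subr0.
    by rewrite homotopy0_one_sub muBl rack_homotopy_mu.
  have := congr1 (mu (cycle_part (count_part phi_bij a))) (IH0 u).
  rewrite muBr (raddfD (mu _)) => e.
  rewrite !addrA [RHS](ACl (2*3*(1*4))) /= -e.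
  by rewrite addrA subrK.
Qed.

Lemma rack_homology_words n :
  isomorphic (rack_homology (permutation_rack phi_bij) n) (W n).
Proof.
apply: (@isomorphic_subquotient _ _ _ _ (fun c w => rack_class n c = w)).
- exact: (@boundaries_cycles (rack_complex (permutation_rack phi_bij)) n).
- by move=> u _ u' _ <- <-; rewrite raddfB.
- by move=> u _; exists (rack_class n u).
- move=> w; exists (rack_cycle n w); last exact: rack_cycleK.
  by rewrite unfold_in /cycles; case: n w => [|n] w //; apply/eqP; apply: rack_bd_cycle.
- by move=> _ _ /asboolP[c ->] <-; apply: rack_class_bd.
- move=> c cZ c0; apply/asboolP; exists (rack_homotopy n c).
  rewrite -[c in LHS]subr0 -(raddf0 (rack_cycle n)) -c0 rack_contraction.
  case: n c cZ {c0} => [|n] c; first by rewrite addr0.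
  rewrite unfold_in /cycles rack_homotopy_bdS => /eqP cZ.
  by rewrite [d n c]cZ raddf0 addr0.
Qed.
End RackContraction.

(** * Filtrations and degenerate spectral sequences *)

Section TagFiltration.
Variables (H : zmodType) (K : nat -> choiceType).
Variable alpha : {additive H -> {freeg {p : nat & K p}}}.
Hypothesis alpha_bij : bijective alpha.

Definition tag_filtration (p : int) : {pred H} :=
  [pred x | `[< forall k : {p : nat & K p}, p < (tag k)%:Z -> coeff k (alpha x) = 0 >]].

Lemma tag_filtration_closed p : zmod_closed (tag_filtration p).
Proof.
split; first by apply/asboolP => k _; rewrite !raddf0.
move=> x y /asboolP xp /asboolP yp; apply/asboolP => k pk.
by rewrite raddfB coeffB xp // yp // subr0.
Qed.

HB.instance Definition _ p :=
  GRing.isZmodClosed.Build H (tag_filtration p) (tag_filtration_closed p).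

Lemma tag_filtrationS p : {subset tag_filtration (p - 1) <= tag_filtration p}.
Proof.
move=> x /asboolP xp; apply/asboolP => k pk; apply: xp.
by apply: lt_trans pk; rewrite ltrBlDr ltrDl.
Qed.

Lemma tag_filtration_lt0 p x : p < 0 -> x \in tag_filtration p -> x = 0.
Proof.
move=> p0 /asboolP xp; have [beta alphaK _] := alpha_bij.
apply: (can_inj alphaK); rewrite raddf0; apply/eqP/freeg_eqP => k.
by rewrite coeff0 xp // (lt_le_trans p0).
Qed.

Lemma tag_filtration_graded (m : nat) :
  isomorphic (subquotient (tag_filtration m) (tag_filtration (m%:Z - 1))) {freeg (K m)}.
Proof.
have [beta alphaK betaK] := alpha_bij.
apply: (@isomorphic_subquotient _ _ _ _ (fun x g =>
  forall k : K m, coeff (existT K m k) (alpha x) = coeff k g)).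
- exact: tag_filtrationS.
- by move=> x g x' g' xg xg' k; rewrite raddfB !coeffB xg xg'.
(* [untag] keeps the basis elements with tag m and sends all others to its default value 0. *)
- move=> x _; exists (free_map (untag 0 (fun l : K m => << l >>)) (alpha x)) => k.
  move: (alpha x); apply: freeg_ext => [u v|u v|[p l]]; rewrite ?coeffB //.
    by rewrite raddfB coeffB.
  rewrite free_mapU coeffU; have [pm|pm] := eqVneq p m.
    move: l; rewrite pm => l; rewrite untagE coeffU eq_Tagged //.
  rewrite untag_dflt ?coeff0 ?pm //.
  by case: eqP => [[/eqP]|]; rewrite ?(negbTE pm) ?mulr0.
- move=> g; pose c : {freeg {p : nat & K p}} := free_map (fun k : K m => << existT K m k >>) g.
  have cE k : coeff k c = if tag k == m then coeff k c else 0.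
    rewrite /c; move: g {c}; apply: freeg_ext => [u v|u v|l].
    - by rewrite raddfB coeffB.
    - by case: ifP => _; rewrite ?subr0 // raddfB coeffB.
    rewrite free_mapU coeffU; case: ifP => // /eqP km.
    by case: eqP => [ek|]; rewrite ?mulr0 //; case: km; rewrite -ek.
  exists (beta c); last first.
    move=> k; rewrite betaK /c; move: g {c cE}; apply: freeg_ext => [u v|u v|l].
    - by rewrite raddfB coeffB.
    - by rewrite coeffB.
    by rewrite free_mapU !coeffU eq_Tagged.
  apply/asboolP => k mk; rewrite betaK cE; case: eqP => // km.
  by move: mk; rewrite km ltxx.
- move=> x g /asboolP xm xg; apply/eqP/freeg_eqP => k; rewrite coeff0 -xg xm //.
  by rewrite /= ltrBlDr ltrDl.
- move=> x /asboolP xm x0; apply/asboolP => -[p k] /= pm.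
  case: (ltngtP m p) => [mp|mp|mp]; first by apply: xm; rewrite ltz_nat.
    by lia.
  by move: k pm; rewrite -mp => k _; rewrite x0 coeff0.
Qed.
End TagFiltration.

Section DegenerateSpectralSequence.
Variables (a : nat) (P : int -> int -> zmodType).

Definition zero_dif (r : nat) (p q p' q' : int) : {additive P p q -> P p' q'} := \0.

Lemma zero_dif_degree (r : nat) p q p' q' (x : P p q) : (a <= r)%N ->
  zero_dif r p q p' q' x != 0 -> p' = p - r%:Z /\ q' = q + r%:Z - 1.
Proof. by rewrite /= eqxx. Qed.

Lemma zero_dif_dif (r : nat) p q p' q' p'' q'' (x : P p q) : (a <= r)%N ->
  zero_dif r p' q' p'' q'' (zero_dif r p q p' q' x) = 0.
Proof. by []. Qed.

Lemma zero_dif_homology (U V W : zmodType) :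
  isomorphic (subquotient (kernel_of (\0 : {additive U -> V})) (image_of (\0 : {additive W -> U}))) U.
Proof.
apply: (@isomorphic_subquotient _ _ _ _ (fun x y => x = y)).
- by move=> x _; rewrite inE.
- by move=> u _ u' _ <- <-.
- by move=> u _; exists u.
- by move=> u; exists u => //; rewrite inE.
- by move=> u v /asboolP[y ->] <-.
- by move=> u _ ->; exact: rpred0.
Qed.

Lemma zero_dif_next_page (r : nat) p q : (a <= r)%N ->
  zmod_iso (subquotient (kernel_of (zero_dif r p q (p - r%:Z) (q + r%:Z - 1)))
                        (image_of (zero_dif r (p + r%:Z) (q - r%:Z + 1) p q))) (P p q).
Proof.
move=> _.
(* [isomorphic] is a proposition, whereas [next_page] asks for the isomorphism itself; [cid] selects
   one. *)
have ex : exists f : zmod_iso (subquotient (kernel_of (zero_dif r p q (p - r%:Z) (q + r%:Z - 1)))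
    (image_of (zero_dif r (p + r%:Z) (q - r%:Z + 1) p q))) (P p q), True.
  by have [f] := zero_dif_homology (P p q) (P (p - r%:Z) (q + r%:Z - 1))
    (P (p + r%:Z) (q - r%:Z + 1)); exists f.
exact: sval (cid ex).
Qed.

Definition degenerate_spectral_sequence : spectral_sequence a :=
  @SpectralSequence a (fun=> P) zero_dif zero_dif_degree zero_dif_dif zero_dif_next_page.
End DegenerateSpectralSequence.

Section Convergence.
Variables (E2 : nat -> nat -> zmodType) (H : nat -> zmodType) (K : nat -> nat -> choiceType).
Hypothesis E2K : forall m p, isomorphic (E2 m p) {freeg (K (m + p) p)}.
Hypothesis HK : forall n, isomorphic (H n) {freeg {p : nat & K n p}}.
Hypothesis K_empty : forall n p, (n < p)%N -> K n p -> False.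

Let P (p q : int) : zmodType := nonneg (fun m => nonneg (E2 m) p) q.

(** The filtration by p is finite: nothing has p < 0, and [K_empty] stops it at p = n. For p > n the
    page vanishes as well, since then q is negative. *)
Lemma degenerate_abuts a : abuts_to (degenerate_spectral_sequence a P) (nonneg H).
Proof.
move=> n; pose Kn := if n is Posz N then K N else fun=> void : choiceType.
have [[alpha alpha_bij]] : isomorphic (nonneg H n) {freeg {p : nat & Kn p}}.
  rewrite /Kn; case: n {Kn} => n; first exact: HK.
  by apply: zmod0_freeg => -[].
exists (fun p => tag_filtration alpha p : zmodClosed (nonneg H n)); split.
- exact: tag_filtrationS.
- by exists (-1) => x; apply: (tag_filtration_lt0 alpha_bij).
- exists n => x; apply/asboolP => -[p k] /= np; exfalso.
  rewrite /Kn in k; case: n {alpha alpha_bij x Kn} k np => n // k np.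
  exact: (K_empty np k).
- move=> p; exists a => // r _; split => //=.
  case: p => m; last first.
    apply: isomorphic_trivial => [x|c].
      by move: x; rewrite /P; case: (n - _) => q; exact: zmod0_eq0.
    have [x [Ax ->]] := subquotient_classP c; apply/subquotient_class_eq0.
    by rewrite (tag_filtration_lt0 alpha_bij _ Ax) ?rpred0.
  apply: isomorphic_trans (isomorphic_sym (tag_filtration_graded alpha_bij m)).
  rewrite /Kn /P; case: n {Kn alpha alpha_bij} => n; last first.
    have -> : Negz n - Posz m = Negz (n + m) by lia.
    exact: zmod0_freeg.
  have [mn|nm] := leqP m n.
    have -> : Posz n - Posz m = Posz (n - m)%N by lia.
    by have := E2K (n - m) m; rewrite subnK.
  have -> : Posz n - Posz m = Negz (m - n.+1) by lia.
  by apply: zmod0_freeg; apply: K_empty.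
Qed.
End Convergence.

Lemma words_empty_letters (S B0 B1 : choiceType) n p :
  (S -> False) -> (B0 -> False) -> (B1 -> False) -> words S B0 B1 n.+1 p -> False.
Proof.
move=> S0 B00 B10; case: n => [|n]; first by case: p.
by case: p => [|p] [[/B00]|] // [/B10].
Qed.

(** * The empty rack *)

Section EmptyRack.
Variables (R : realType) (X : choiceType) (phi : X -> X) (phi_bij : bijective phi).
Hypothesis X0 : X -> False.

(** On both sides only the empty word remains: the homology is one copy of Z, in degree 0, which is
    what row 0 contributes. *)
Lemma rack_homology_empty (S B0 B1 : choiceType) n :
  (S -> False) -> (B0 -> False) -> (B1 -> False) ->
  isomorphic (rack_homology (permutation_rack phi_bij) n) {freeg {p : nat & words S B0 B1 n p}}.
Proof.
move=> S0 B00 B10.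
have chains0 m (c : {freeg (word (permutation_rack phi_bij) m.+1)}) : c = 0.
  by apply: freeg_empty => w; apply: X0 (w ord0).
case: n => [|n]; last first.
  apply: isomorphic_trivial => c.
    have [x [Ax ->]] := subquotient_classP c; apply/subquotient_class_eq0.
    by rewrite (chains0 _ x) rpred0.
  by apply: freeg_empty => -[p w]; apply: (words_empty_letters S0 B00 B10 w).
apply: (@isomorphic_trans {freeg (word (permutation_rack phi_bij) 0)}).
  apply: (@isomorphic_subquotient _ _ _ _ (fun x y => x = y)).
  - by [].
  - by move=> u _ u' _ <- <-.
  - by move=> u _; exists u.
  - by move=> u; exists u.
  - by move=> u v /asboolP[y ->] <-; rewrite (chains0 _ y) raddf0.
  - by move=> u _ ->; exact: rpred0.
apply: isomorphic_freeg; exists (fun=> existT (words S B0 B1 0) 0 tt).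
exists (fun=> ffun0 (card_ord 0) : word (permutation_rack phi_bij) 0) => [w|]; first by apply/ffunP => -[].
by case=> -[|p] // [].
Qed.

Lemma homotopy_orbits_homology_empty n (x : singular_homology R (homotopy_orbits R phi_bij) n) :
  x = 0.
Proof.
have [z [Az ->]] := subquotient_classP x; apply/subquotient_class_eq0.
suff -> : z = 0 by rewrite rpred0.
apply: freeg_empty => s.
by have [a _] := covering_map_surj (s (vertex R ord0)); apply: X0 a.2.
Qed.
End EmptyRack.

Lemma homotopy_orbits_E2 (R : realType) (X : choiceType) (phi : X -> X)
    (phi_bij : bijective phi) (s0 : orbits phi_bij) m p :
  isomorphic (E2_row R (homotopy_orbits R phi_bij) m p)
    {freeg (words (orbits phi_bij) (punctured s0) (finite_orbits phi_bij) (m + p) p)}.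
Proof.
have [F Fb Fdeg] := homotopy_orbits_H0 R phi_bij.
apply: E2_row_words.
- by split; exists F.
- exact: homotopy_orbits_H1.
- exact: homotopy_orbits_H2.
- exact: reduced_homology0 Fb Fdeg.
- exact: isomorphic_trans (reduced_homologyS R _ 0) (homotopy_orbits_H1 R phi_bij).
- by move=> n; apply: reduced_homology_trivial; exact: homotopy_orbits_H2.
Qed.

Theorem theoremA (R : realType) (X : choiceType) (phi : X -> X)
    (phi_bij : bijective phi) :
  exists E : spectral_sequence 2,
    [/\ forall p q : int,
          isomorphic (page E 2 p q) (E2_page R (homotopy_orbits R phi_bij) p q),
        abuts_to E (nonneg (rack_homology (permutation_rack phi_bij)))
      & degenerate E].
Proof.
exists (degenerate_spectral_sequence 2 (E2_page R (homotopy_orbits R phi_bij))).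
split=> [p q||//]; first exact: isomorphic_refl.
have words_gt S B0 B1 n p : (n < p)%N -> words S B0 B1 n p -> False.
  by move=> np; apply: words_empty; [apply: leq_ltn_trans np|apply: ltnW].
have [[x]|nX] := pselect (inhabited X).
  pose s0 := orbit_of phi_bij x.
  exact: (degenerate_abuts (homotopy_orbits_E2 R s0) (rack_homology_words s0)
    (@words_gt _ _ _) 2).
have X0 : X -> False by move=> x; apply: nX.
have H0 := homotopy_orbits_homology_empty (R := R) (phi_bij := phi_bij) X0.
have V0 (D : {freeg void}) : D = 0 by apply: freeg_empty.
have E2 m p : isomorphic (E2_row R (homotopy_orbits R phi_bij) m p)
    {freeg (words void void void (m + p) p)}.
  by apply: E2_row_words => *; first [exact: H0|exact: reduced_homology_trivial (H0 _) _
    |apply: isomorphic_trivial => //; exact: reduced_homology_trivial (H0 _)].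
apply: (degenerate_abuts E2 _ (@words_gt _ _ _) 2) => n.
by apply: rack_homology_empty.
Qed.
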